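(* The following decision problem is algorithmically undecidable (no algorithm, i.e. no Turing machine, solves it correctly on all admissible instances). Instance: a dimension $d\ge 1$; the transition probabilities $p(\Lambda,\Delta)$, $\Lambda\subset\{1,\dots,d\}$, $\Delta\in\{-1,0,1\}^d$, of an irreducible constrained homogeneous random walk in $\mathcal{Z}_+^d$; a vector $w\in\Re_+^d$ such that for some $\gamma>0$ and every nonempty $\Lambda\subset\{1,\dots,d\}$ $$\sum_{\Delta\in\{-1,0,1\}^d}(w^T\Delta)\,p(\Lambda,\Delta)\le-\gamma;$$ and a rational number $0\le r\le 1$. Question: does the unique stationary distribution $\pi$ of the walk satisfy $\pi(0)\le r$, where $0$ is the origin of $\mathcal{Z}_+^d$?
   Context: $\mathcal{Z}_+^d$ is the set of $d$-dimensional vectors with nonnegative integer components, and $\Re_+$ is the set of nonnegative reals. For $\Lambda\subset\{1,\dots,d\}$ the corresponding face is $\mathcal{Z}_\Lambda=\{z\in\mathcal{Z}_+^d: z_i>0 \text{ for } i\in\Lambda,\ z_i=0\text{ for } i\notin\Lambda\}$. A constrained homogeneous random walk in $\mathcal{Z}_+^d$ is a Markov chain $Q(t)$, $t=0,1,2,\dots$, with state space $\mathcal{Z}_+^d$ specified by finitely many numbers $p(\Lambda,\Delta)\ge 0$ ($\Lambda\subset\{1,\dots,d\}$, $\Delta\in\{-1,0,1\}^d$) such that $\sum_{\Delta}p(\Lambda,\Delta)=1$ for every $\Lambda$, and $p(\Lambda,\Delta)=0$ whenever $\Delta_i=-1$ for some $i\notin\Lambda$. If $Q(t)\in\mathcal{Z}_\Lambda$,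 then $Q(t+1)=Q(t)+\Delta$ with probability $p(\Lambda,\Delta)$. Let $p^{(t)}(q,q')$ denote the $t$-step transition probabilities. Convention on irreducibility: it is assumed that every state $q$ satisfies $p^{(t)}(q,0)>0$ for some $t\ge 0$; this is what ''irreducible'' means here. The displayed condition on $w$ says that $\Phi(q)=w^Tq$ is a linear Lyapunov function; under it the walk is positive recurrent and has a unique stationary distribution $\pi$, i.e. a probability distribution on $\mathcal{Z}_+^d$ with $\sum_{q'}\pi(q')p(q',q)=\pi(q)$ for all $q$, where $p(q,q')=p(\Lambda,q'-q)$ for $q\in\mathcal{Z}_\Lambda$. Instances are finite data: the numbers $p(\Lambda,\Delta)$ and the entries of $w$ are rational numbers given explicitly. *)

(* Defs.v *)
From mathcomp Require Import all_boot all_order all_algebra.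
From mathcomp Require Import boolp classical_sets reals ereal esum.

Set Implicit Arguments.
Unset Strict Implicit.
Unset Printing Implicit Defensive.

Import Order.TTheory GRing.Theory Num.Theory.

Local Open Scope ring_scope.

Inductive tape_move := MoveLeft | MoveRight | Stay.

(** Deterministic machines with one two-way infinite tape.  The tape alphabet
    consists of the blank [None], the input letters [Some (inl a)] and the
    auxiliary letters [Some (inr g)].  A transition either continues, or halts
    with a Boolean answer. *)
Record turing_machine (A : finType) := TuringMachine {
  tm_state : finType;
  tm_aux : finType;
  tm_start : tm_state;
  tm_trans : tm_state -> option (A + tm_aux) ->
             (tm_state * option (A + tm_aux) * tape_move) + bool
}.

Section TuringMachineRuns.
Variables (A : finType) (M : turing_machine A).

Definition tm_symbol : finType := option (A + tm_aux M).

(** [cfg_right] starts with the scanned cell, [cfg_left] with the cell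
    immediately to its left; cells beyond either list are blank. *)
Record tm_config := TMConfig {
  cfg_state : tm_state M;
  cfg_left : seq tm_symbol;
  cfg_right : seq tm_symbol
}.

Definition tm_init (u : seq A) : tm_config :=
  TMConfig (tm_start M) [::] [seq Some (inl a) | a <- u].

Definition tm_step (c : tm_config) : tm_config + bool :=
  let l := cfg_left c in
  let r := behead (cfg_right c) in
  match tm_trans (cfg_state c) (head None (cfg_right c)) with
  | inr b => inr b
  | inl (s, x, MoveLeft) =>
      inl (TMConfig s (behead l) (head None l :: x :: r))
  | inl (s, x, MoveRight) => inl (TMConfig s (x :: l) r)
  | inl (s, x, Stay) => inl (TMConfig s l (x :: r))
  end.

Fixpoint tm_run (n : nat) (c : tm_config) : option bool :=
  if n is n'.+1 then
    match tm_step c with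
    | inr b => Some b
    | inl c' => tm_run n' c'
    end
  else None.

Definition tm_answers (u : seq A) (b : bool) : Prop :=
  exists n : nat, tm_run n (tm_init u) = Some b.

(** No requirement is made on instances that are not admissible. *)
Definition tm_decides (T : Type) (encode : T -> seq A)
    (admissible question : T -> Prop) : Prop :=
  forall I : T, admissible I ->
    exists b : bool, tm_answers (encode I) b /\ (b = true <-> question I).

End TuringMachineRuns.

(** A jump [D] stands for the vector of [{-1, 0, 1}^d] with coordinates
    [jump_coord (D i)]. *)
Definition jump (d : nat) := {ffun 'I_d -> 'I_3}.

Definition jump_coord (x : 'I_3) : int := x%:Z - 1.

Definition walk_state (d : nat) := {ffun 'I_d -> nat}.

Definition origin (d : nat) : walk_state d := [ffun=> 0%N].

Definition transition_table (d : nat) := {set 'I_d} -> jump d -> rat.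

Section Walk.
Variables (d : nat) (p : transition_table d).

Definition is_transition_table : Prop :=
  [/\ forall L D, 0 <= p L D,
      forall L, \sum_(D : jump d) p L D = 1
    & forall (L : {set 'I_d}) (D : jump d) i, i \notin L ->
        jump_coord (D i) = -1 -> p L D = 0].

Definition face_of (q : walk_state d) : {set 'I_d} := [set i | (0 < q i)%N].

(** The state [q + D].  The absolute value only matters when [q + D] has a
    negative coordinate, and such a jump has probability 0 under
    [is_transition_table]. *)
Definition move (q : walk_state d) (D : jump d) : walk_state d :=
  [ffun i => absz ((q i)%:Z + jump_coord (D i))].

Definition trans_prob (q q' : walk_state d) : rat :=
  \sum_(D : jump d | move q D == q') p (face_of q) D.

Fixpoint trans_prob_iter (t : nat) (q q' : walk_state d) : rat :=
  if t is t'.+1 then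
    \sum_(D : jump d) p (face_of q) D * trans_prob_iter t' (move q D) q'
  else (q == q')%:R.

Definition irreducible_walk : Prop :=
  forall q : walk_state d, exists t : nat,
    0 < trans_prob_iter t q (origin d).

(** All data being rational, a positive real [gamma] exists iff a positive
    rational one does. *)
Definition linear_lyapunov (w : 'I_d -> rat) : Prop :=
  exists2 gamma : rat, 0 < gamma &
    forall L : {set 'I_d}, L != finset.set0 ->
      \sum_(D : jump d) (\sum_(i < d) w i * (jump_coord (D i))%:~R) * p L D
        <= - gamma.

Definition stationary_distribution (R : realType) (pi : walk_state d -> R) :
    Prop :=
  [/\ forall q, 0 <= pi q,
      \esum_(q in [set: walk_state d]%classic) (pi q)%:E = 1%E
    & forall q, \esum_(q' in [set: walk_state d]%classic)
        (pi q' * ratr (trans_prob q' q))%:E = (pi q)%:E].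

End Walk.

Record walk_instance := WalkInstance {
  wi_dim : nat;
  wi_p : transition_table wi_dim;
  wi_w : 'I_wi_dim -> rat;
  wi_r : rat
}.

Definition walk_admissible (I : walk_instance) : Prop :=
  [/\ (0 < wi_dim I)%N,
      is_transition_table (@wi_p I) /\ irreducible_walk (@wi_p I),
      forall i, 0 <= @wi_w I i,
      linear_lyapunov (@wi_p I) (@wi_w I)
    & 0 <= wi_r I <= 1].

Definition walk_question (R : realType) (I : walk_instance) : Prop :=
  exists pi : walk_state (wi_dim I) -> R,
    unique (@stationary_distribution _ (@wi_p I) R) pi /\
    pi (origin (wi_dim I)) <= ratr (wi_r I).

(** Code alphabet: [Some b] is a binary digit (or a sign), [None] is an end marker. *)
Definition letter : finType := option bool.

(** Binary digits, least significant first, followed by the end marker. *)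
Definition encode_nat (n : nat) : seq letter :=
  rcons [seq Some (odd (n %/ 2 ^ i)) | i <- iota 0 (up_log 2 n.+1)] None.

Definition encode_int (z : int) : seq letter := Some (z < 0) :: encode_nat (absz z).

Definition encode_rat (x : rat) : seq letter :=
  encode_int (numq x) ++ encode_nat (absz (denq x)).

(** All words of length [n] over [s], in lexicographic order. *)
Fixpoint words (T : Type) (s : seq T) (n : nat) : seq (seq T) :=
  if n is n'.+1 then [seq x :: u | x <- s, u <- words s n'] else [:: [::]].

Definition all_faces (d : nat) : seq {set 'I_d} :=
  [seq [set i : 'I_d | nth false u i] | u <- words [:: false; true] d].

Definition all_jumps (d : nat) : seq (jump d) :=
  [seq [ffun i : 'I_d => nth ord0 u i] | u <- words (enum 'I_3) d].

Definition encode_walk_instance (I : walk_instance) : seq letter :=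
  encode_nat (wi_dim I)
    ++ flatten [seq encode_rat (wi_p L D)
               | L <- all_faces (wi_dim I), D <- all_jumps (wi_dim I)]
    ++ flatten [seq encode_rat (wi_w i) | i <- enum 'I_(wi_dim I)]
    ++ encode_rat (wi_r I).

(* Main.v *)
Require Import Defs.
From mathcomp Require Import all_boot all_order all_algebra.
From mathcomp Require Import boolp classical_sets reals ereal esum.
From mathcomp Require Import topology normedtype sequences.
From mathcomp Require Import zify ring lra.

Set Implicit Arguments.
Unset Strict Implicit.
Unset Printing Implicit Defensive.

Import Order.TTheory GRing.Theory Num.Theory.
Import numFieldNormedType.Exports.

(** A constrained random walk can run a counter program: registers are
    coordinates, the program counter is a token among further coordinates, and
    since a jump depends only on which coordinates are positive, each instruction
    (increment, or decrement with a test for zero) is one jump.  To make the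
    linear Lyapunov function exist, the walk is killed: while it is alive it
    makes a step of the program with probability 1/2, and otherwise it drains,
    all positive coordinates going down by 1 at each time until the origin is
    reached, where the program is started again ([killed_weight]).

    A clock coordinate that goes up at every step of the program is always the
    largest one, so an excursion that dies at age [g] takes [g.+1] further times
    to drain, no matter what the program did.  With [A] the sum over [g] of the
    probabilities of being alive at age [g], an excursion has mean length
    [2 * A], and the origin has stationary probability [(2 * A)^-1]
    ([occupation_stationary], [occupation_origin]).  If the program never halts
    then [A = 2] and this is 1/4.  A program that has halted drains with
    probability 1, which makes [A < 2] and the probability larger than 1/4.
    So with the threshold 1/4 the question is whether the program runs forever
    ([killed_walk_question]).  Uniqueness of the stationary distribution is a
    general fact on irreducible walks ([stationary_unique]).

    Suppose that a Turing machine [M] decides the problem.  A diagonal argument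
    gives an instance on which it fails: a walk whose program computes the
    encoding of that very walk, runs [M] on it, and halts exactly if [M] accepts.
    The program gets hold of the encoding as follows.  The jumps of the core, the
    part of the walk that runs the program, form a finite table, coded by one
    number [F]; the core size [d0] and [F] are paired into a number [e].
    The instance has [e] additional coordinates whose only purpose is to be
    counted into the first register at the start of an excursion, so the
    program, which is fixed once [M] is, receives as input the description of the
    core that runs it.  The probabilities of the instance take only the values 0,
    1/2 and 1, and which value occurs is an arithmetic function of [d0], [F] and
    the indices of the face and the jump ([weight_codeE]); hence the encoding is
    computable from [e] ([computable_instance_code]).  Computability means here:
    by register programs, closed under primitive recursion; runs of Turing
    machines are covered ([computable_run]), and a last unbounded search
    ([exists_search]) looks for a number of steps after which [M] accepts. *)

(** * Register programs and flow charts *)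

Definition store := nat -> nat.

Definition upd (s : store) (r v : nat) : store :=
  fun i => if i == r then v else s i.

Lemma upd_eq s r v : upd s r v r = v.
Proof. by rewrite /upd eqxx. Qed.

Lemma upd_neq s r v i : i != r -> upd s r v i = s i.
Proof. by rewrite /upd => /negbTE->. Qed.

(** Decrements occur only in the test of a loop.  This is enough for primitive
    recursion, and a loop whose body raises its own counter again is an
    unbounded search. *)
Inductive cmd := Skip | Inc of nat | Seq of cmd & cmd | Loop of nat & cmd.

Inductive exec : cmd -> store -> store -> Prop :=
| ExecSkip s : exec Skip s s
| ExecInc r s : exec (Inc r) s (upd s r (s r).+1)
| ExecSeq c1 c2 s1 s2 s3 :
    exec c1 s1 s2 -> exec c2 s2 s3 -> exec (Seq c1 c2) s1 s3
| ExecLoopEnd r c s : s r = 0 -> exec (Loop r c) s s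
| ExecLoop r c m s1 s2 s3 :
    s1 r = m.+1 -> exec c (upd s1 r m) s2 -> exec (Loop r c) s2 s3 ->
    exec (Loop r c) s1 s3.

Inductive instr :=
| IJmp of nat
| IInc of nat & nat
| IDec of nat & nat & nat.

Definition flow_config := (nat * store)%type.

Definition flow_step (P : seq instr) (c : flow_config) : flow_config :=
  let: (k, s) := c in
  match nth (IJmp 0) P k with
  | IJmp t => (t, s)
  | IInc r t => (t, upd s r (s r).+1)
  | IDec r t t' => if s r is m.+1 then (t, upd s r m) else (t', s)
  end.

Fixpoint cmd_size (c : cmd) : nat :=
  match c with
  | Skip | Inc _ => 1
  | Seq c1 c2 => cmd_size c1 + cmd_size c2
  | Loop _ c => (cmd_size c).+1
  end.

(** The code of [c] for address [k], with exit to address [x].  The exit of the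
    body of a loop is the head of the loop, so no closing jump is needed. *)
Fixpoint flat (c : cmd) (k x : nat) : seq instr :=
  match c with
  | Skip => [:: IJmp x]
  | Inc r => [:: IInc r x]
  | Seq c1 c2 => flat c1 k (k + cmd_size c1) ++ flat c2 (k + cmd_size c1) x
  | Loop r c => IDec r k.+1 x :: flat c k.+1 k
  end.

Lemma size_flat c k x : size (flat c k x) = cmd_size c.
Proof.
by elim: c k x => //= [c1 IH1 c2 IH2|r c IH] k x; rewrite ?size_cat ?IH1 ?IH2 ?IH.
Qed.

Definition placed (P l : seq instr) (k : nat) :=
  forall i, i < size l -> nth (IJmp 0) P (k + i) = nth (IJmp 0) l i.

Lemma placed_catl P l1 l2 k : placed P (l1 ++ l2) k -> placed P l1 k.
Proof.
move=> H i lt_i; rewrite H ?nth_cat ?lt_i // size_cat.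
exact: leq_trans lt_i (leq_addr _ _).
Qed.

Lemma placed_catr P l1 l2 k :
  placed P (l1 ++ l2) k -> placed P l2 (k + size l1).
Proof.
move=> H i lt_i; rewrite -addnA H ?size_cat ?ltn_add2l // nth_cat.
by rewrite ltnNge leq_addr /= addKn.
Qed.

Lemma flow_run_exec P c s s' k x : exec c s s' -> placed P (flat c k x) k ->
  exists t, iter t (flow_step P) (k, s) = (x, s').
Proof.
move=> E; elim: E k x => {c s s'}.
- move=> s k x H; exists 1.
  by have := H 0 isT; rewrite /= addn0 /flow_step => ->.
- move=> r s k x H; exists 1.
  by have := H 0 isT; rewrite /= addn0 /flow_step => ->.
- move=> c1 c2 s1 s2 s3 _ IH1 _ IH2 k x /= H.
  have [t1 E1] := IH1 _ _ (placed_catl H).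
  have := placed_catr H; rewrite size_flat => /IH2 [t2 E2].
  by exists (t2 + t1); rewrite iterD E1.
- move=> r c s Es k x H; exists 1.
  by have := H 0 isT; rewrite /= addn0 /flow_step => ->; rewrite Es.
- move=> r c m s1 s2 s3 Es _ IH1 _ IH2 k x /= H.
  have Hb : placed P (flat c k.+1 k) k.+1.
    by have /= := @placed_catr P [:: IDec r k.+1 x] _ _ H; rewrite addn1.
  have [t1 E1] := IH1 _ _ Hb; have [t2 E2] := IH2 _ _ H.
  exists (t2 + (t1 + 1)); rewrite !iterD /=.
  have := H 0 isT; rewrite /= addn0 => ->.
  by rewrite Es E1.
Qed.

(** * Computable functions on lists of numbers *)

(** The arguments sit in the registers listed in [vars]; every register below
    [m] survives, and the result appears in register [m].  Quantifying over [m]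
    is what lets a computation be nested in another one that keeps its
    intermediate values above the arguments. *)
Definition computable (f : seq nat -> nat) : Prop :=
  forall (vars : seq nat) (m : nat), all (fun v => v < m) vars ->
    exists c, forall s : store, exists s',
      [/\ exec c s s', s' m = f [seq s v | v <- vars]
        & forall i, i < m -> s' i = s i].

Lemma computable_ext f g : f =1 g -> computable f -> computable g.
Proof.
move=> E H vars m lt_v; have [c Hc] := H vars m lt_v; exists c => s.
by have [s' [H1 H2 H3]] := Hc s; exists s'; rewrite H2 E.
Qed.

Lemma exec_clear m s : exists s',
  [/\ exec (Loop m Skip) s s', s' m = 0 & forall i, i != m -> s' i = s i].
Proof.
move E: (s m) => a; elim: a s E => [|a IH] s E.
  by exists s; split => //; apply: ExecLoopEnd.
have [|s' [H1 H2 H3]] := IH (upd s m a); first by rewrite upd_eq.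
exists s'; split => //; last by move=> i ne; rewrite H3 // upd_neq.
by apply: ExecLoop E (ExecSkip _) H1.
Qed.

Lemma exec_move a b s : a != b -> exists s',
  [/\ exec (Loop a (Inc b)) s s', s' b = s b + s a
    & forall i, i != a -> i != b -> s' i = s i].
Proof.
move=> ne; move E: (s a) => x; elim: x s E => [|x IH] s E.
  by exists s; split; [apply: ExecLoopEnd | rewrite addn0 |].
pose s1 := upd s a x; pose s2 := upd s1 b (s1 b).+1.
have [|s' [H1 H2 H3]] := IH s2; first by rewrite /s2 upd_neq // /s1 upd_eq.
exists s'; split.
- exact: ExecLoop E (ExecInc _ _) H1.
- by rewrite H2 /s2 upd_eq /s1 upd_neq 1?eq_sym // addSnnS.
- by move=> i n1 n2; rewrite H3 // /s2 /s1 !upd_neq.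
Qed.

(** Two copies are made because reading a register destroys it: one copy is the
    result and the other is moved back. *)
Lemma exec_dup v a b s : v != a -> v != b -> a != b -> exists s',
  [/\ exec (Loop v (Seq (Inc a) (Inc b))) s s', s' a = s a + s v,
      s' b = s b + s v, s' v = 0
    & forall i, [&& i != a, i != b & i != v] -> s' i = s i].
Proof.
move=> va vb ab; move E: (s v) => x; elim: x s E => [|x IH] s E.
  by exists s; split => //; [apply: ExecLoopEnd | rewrite addn0 | rewrite addn0].
pose s1 := upd s v x; pose s2 := upd s1 a (s1 a).+1.
pose s3 := upd s2 b (s2 b).+1.
have Ev : s3 v = x.
  by rewrite /s3 upd_neq // /s2 upd_neq // /s1 upd_eq.
have Ea : s3 a = (s a).+1.
  by rewrite /s3 upd_neq // /s2 upd_eq /s1 upd_neq // eq_sym.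
have Eb : s3 b = (s b).+1.
  by rewrite /s3 upd_eq /s2 upd_neq 1?eq_sym // /s1 upd_neq // eq_sym.
have [s' [H1 H2 H3 H4 H5]] := IH s3 Ev.
exists s'; split => //.
- by apply: ExecLoop E _ H1; apply: ExecSeq; apply: ExecInc.
- by rewrite H2 Ea addSnnS.
- by rewrite H3 Eb addSnnS.
- move=> i /and3P[n1 n2 n3]; rewrite H5 ?n1 ?n2 ?n3 //.
  by rewrite /s3 /s2 /s1 !upd_neq.
Qed.

Lemma computable0 : computable (fun=> 0).
Proof.
move=> vars m _; exists (Loop m Skip) => s.
have [s' [H1 H2 H3]] := exec_clear m s; exists s'; split => // i lt_i.
by rewrite H3 // neq_ltn lt_i.
Qed.

Lemma computable_nth j : computable (fun l => nth 0 l j).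
Proof.
move=> vars m /allP Hv.
case: (ltnP j (size vars)) => [lt_j|ge_j]; last first.
  have [c Hc] := computable0 (introT allP Hv).
  by exists c => s; rewrite nth_default ?size_map.
pose v := nth 0 vars j.
have lt_v : v < m by apply: Hv; apply: mem_nth.
exists (Seq (Loop m Skip) (Seq (Loop m.+1 Skip)
         (Seq (Loop v (Seq (Inc m) (Inc m.+1))) (Loop m.+1 (Inc v))))) => s.
rewrite (nth_map 0) // -/v.
have [s1 [A1 A2 A3]] := exec_clear m s.
have [s2 [B1 B2 B3]] := exec_clear m.+1 s1.
have [|||s3 [C1 C2 C3 C4 C5]] := @exec_dup v m m.+1 s2; try lia.
have [|s4 [D1 D2 D3]] := @exec_move m.+1 v s3; first lia.
exists s4; split.
- by apply: ExecSeq A1 _; apply: ExecSeq B1 _; apply: ExecSeq C1 D1.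
- rewrite D3 ?C2; try lia.
  by rewrite !B3 ?A2 ?A3 //; lia.
- move=> i lt_i; case: (eqVneq i v) => [->|ne].
    by rewrite D2 C4 C3 B2 !add0n B3 ?A3 //; lia.
  rewrite D3 ?C5 ?B3 ?A3 //; lia.
Qed.

Lemma computableS f : computable f -> computable (fun l => (f l).+1).
Proof.
move=> H vars m lt_v; have [c Hc] := H vars m lt_v.
exists (Seq c (Inc m)) => s; have [s' [H1 H2 H3]] := Hc s.
exists (upd s' m (s' m).+1); split.
- exact: ExecSeq H1 (ExecInc _ _).
- by rewrite upd_eq H2.
- by move=> i lt_i; rewrite upd_neq ?H3 // neq_ltn lt_i.
Qed.

Lemma computable_drop j f :
  computable f -> computable (fun l => f (drop j l)).
Proof.
move=> H vars m lt_v.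
have [|c Hc] := H (drop j vars) m.
  by apply/allP => v /mem_drop /(allP lt_v).
by exists c => s; have := Hc s; rewrite map_drop.
Qed.

(** Primitive recursion.  The loop counts down, so round [k] of the list
    [iota 0 n] is entered with the value already obtained from the indices above
    [k], which is how [foldr] associates. *)
Lemma computable_foldr (n a : seq nat -> nat) (b : nat -> nat -> seq nat -> nat) :
  computable n -> computable a ->
  computable (fun l => b (nth 0 l 0) (nth 0 l 1) (drop 2 l)) ->
  computable (fun l => foldr (fun k acc => b k acc l) (a l) (iota 0 (n l))).
Proof.
move=> Hn Ha Hb vars m lt_v.
have lt_v1 : all (fun v => v < m.+1) vars.
  by apply: sub_all lt_v => v /ltnW.
have lt_v2 : all (fun v => v < m.+2) (m :: m.+1 :: vars).
  by rewrite /= ltnS leqnSn ltnSn /=; apply: sub_all lt_v1 => v /ltnW.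
have [cn Hcn] := Hn vars m lt_v.
have [ca Hca] := Ha vars m.+1 lt_v1.
have [cb Hcb] := Hb (m :: m.+1 :: vars) m.+2 lt_v2.
(* Register [m] counts down, [m.+1] accumulates and [m.+2] receives [b]. *)
pose body := Seq cb (Seq (Loop m.+1 Skip) (Loop m.+2 (Inc m.+1))).
exists (Seq cn (Seq ca (Seq (Loop m body) (Loop m.+1 (Inc m))))) => s.
set l := [seq s v | v <- vars].
have same s' : (forall i, i < m -> s' i = s i) -> [seq s' v | v <- vars] = l.
  by move=> E; apply/eq_in_map => v /(allP lt_v); apply: E.
have loop s1 : (forall i, i < m -> s1 i = s i) -> exists s2,
    [/\ exec (Loop m body) s1 s2, s2 m = 0,
        s2 m.+1 = foldr (fun k acc => b k acc l) (s1 m.+1) (iota 0 (s1 m))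
      & forall i, i < m -> s2 i = s i].
  move E: (s1 m) => x; elim: x s1 E => [|x IH] s1 E S1.
    by exists s1; split => //; apply: ExecLoopEnd.
  have [s2 [A1 A2 A3]] := Hcb (upd s1 m x).
  have [s3 [B1 B2 B3]] := exec_clear m.+1 s2.
  have [|s4 [C1 C2 C3]] := @exec_move m.+2 m.+1 s3; first lia.
  have S4 i : i < m -> s4 i = s i.
    move=> lt_i; rewrite C3 ?B3 ?A3 ?upd_neq ?S1 //; lia.
  have E4 : s4 m = x by rewrite C3 ?B3 ?A3 ?upd_eq //; lia.
  have [s5 [D1 D2 D3 D4]] := IH s4 E4 S4.
  exists s5; split => //.
  - by apply: ExecLoop E _ D1; apply: ExecSeq A1 _; apply: ExecSeq B1 C1.
  - rewrite D3 -[x.+1]addn1 iotaD foldr_cat /= add0n; congr foldr.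
    rewrite C2 B2 add0n B3; last by lia.
    rewrite A2 /= upd_eq upd_neq; last by lia.
    rewrite drop0; congr b.
    rewrite -[RHS](same s1) //; apply/eq_in_map => v /(allP lt_v) lt.
    by rewrite upd_neq // neq_ltn lt.
have [s1 [A1 A2 A3]] := Hcn s.
have [s2 [B1 B2 B3]] := Hca s1.
have S2 i : i < m -> s2 i = s i by move=> lt_i; rewrite B3 ?A3 // ltnW.
have [s3 [C1 C2 C3 C4]] := loop s2 S2.
have [|s4 [D1 D2 D3]] := @exec_move m.+1 m s3; first lia.
exists s4; split.
- by apply: ExecSeq A1 _; apply: ExecSeq B1 _; apply: ExecSeq C1 D1.
- rewrite D2 C2 add0n C3 B2 B3 // A2; congr foldr.
  by rewrite same.
- by move=> i lt_i; rewrite D3 ?C4 //; lia.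
Qed.

(** * Arithmetic is computable *)

(** The database solves goals [computable (fun l => e)] by the shape of [e]. *)
Create HintDb computable.
Ltac computability := solve [auto 200 with computable nocore].
#[global] Hint Resolve computable0 computable_nth computableS : computable.
#[global] Hint Extern 1 (computable (fun l => _ (drop _ l))) =>
  (eapply computable_drop; eassumption) : computable.
#[global] Hint Extern 0 (computable _) => eassumption : computable.

Lemma computable_const k : computable (fun=> k).
Proof. elim: k => [|k IH]; computability. Qed.
#[global] Hint Resolve computable_const : computable.

Lemma foldr_iotaS T (b : nat -> T -> T) a n :
  foldr b a (iota 0 n.+1) = foldr b (b n a) (iota 0 n).
Proof. by rewrite -addn1 iotaD foldr_cat. Qed.

Section Addition.
Variables f g : seq nat -> nat.
Hypotheses (Hf : computable f) (Hg : computable g).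

Lemma computable_addn : computable (fun l => f l + g l).
Proof.
apply: (computable_ext _
  (computable_foldr (b := fun _ acc _ => acc.+1) Hg Hf _)); last computability.
move=> l; elim: (g l) => [|n IH]; first by rewrite addn0.
rewrite addnS -IH -[n.+1]addn1 iotaD foldr_cat /=.
by elim: (iota 0 n) => //= k s ->.
Qed.

End Addition.
#[global] Hint Resolve computable_addn : computable.

Lemma foldr_sum (F : nat -> nat) a s :
  foldr (fun k acc => acc + F k) a s = a + \sum_(k <- s) F k.
Proof.
elim: s => [|k s IH] /=; first by rewrite big_nil addn0.
by rewrite big_cons IH addnAC addnA.
Qed.

Section Iteration.
Variables (n : seq nat -> nat) (F : nat -> seq nat -> nat).
Hypotheses (Hn : computable n)
  (HF : computable (fun l => F (nth 0 l 0) (drop 2 l))).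

Lemma computable_sum : computable (fun l => \sum_(k <- iota 0 (n l)) F k l).
Proof.
apply: (computable_ext _ (computable_foldr (b := fun k acc l => acc + F k l)
  Hn computable0 _)); last computability.
by move=> l; rewrite foldr_sum.
Qed.

End Iteration.

Section Multiplication.
Variables f g : seq nat -> nat.
Hypotheses (Hf : computable f) (Hg : computable g).

Lemma computable_muln : computable (fun l => f l * g l).
Proof.
apply: (computable_ext _ (computable_sum (F := fun _ l => f l) Hg _));
  last computability.
by move=> l; rewrite big_const_seq count_predT size_iota iter_addn_0.
Qed.

Lemma computable_pred : computable (fun l => (f l).-1).
Proof.
have H0 n : \sum_(j <- iota 0 n) 1 = n.
  by rewrite big_const_seq count_predT size_iota iter_addn_0 mul1n.
have Hsg k : foldr (fun _ _ => 1) 0 (iota 0 k) = (0 < k) by case: k.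
have Hpos F : computable F -> computable (fun l => 0 < F l : nat).
  move=> HF; apply: (computable_ext (fun l => Hsg (F l))).
  by apply: (computable_foldr (b := fun _ _ _ => 1)); computability.
apply: (computable_ext _ (computable_sum (F := fun k _ => 0 < k) Hf _));
  last by apply: Hpos; computability.
move=> l; elim: (f l) => [|k IH]; first by rewrite big_nil.
rewrite -addn1 iotaD big_cat IH /= big_cons big_nil add0n addn0.
by case: k {IH} => //= k; rewrite addn1.
Qed.

End Multiplication.
#[global] Hint Resolve computable_muln computable_pred : computable.

Section Subtraction.
Variables f g : seq nat -> nat.
Hypotheses (Hf : computable f) (Hg : computable g).

Lemma computable_subn : computable (fun l => f l - g l).
Proof.
apply: (computable_ext _
  (computable_foldr (b := fun _ acc _ => acc.-1) Hg Hf _)); last computability.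
move=> l; elim: (g l) => [|n IH]; first by rewrite subn0.
rewrite subnS -IH -[n.+1]addn1 iotaD foldr_cat /=.
by elim: (iota 0 n) => //= k s ->.
Qed.

Lemma computable_expn : computable (fun l => f l ^ g l).
Proof.
apply: (computable_ext _
  (computable_foldr (b := fun _ acc l => f l * acc) Hg (computable_const 1) _));
  last computability.
move=> l; elim: (g l) => [|n IH] //; rewrite expnS -IH foldr_iotaS.
elim: (iota 0 n) 1 => //= k s IHs x.
by rewrite IHs.
Qed.

End Subtraction.
#[global] Hint Resolve computable_subn computable_expn : computable.

Section Booleans.
Variables P Q : seq nat -> bool.
Hypotheses (HP : computable (fun l => P l)) (HQ : computable (fun l => Q l)).

Lemma computable_negb : computable (fun l => ~~ P l).
Proof.
apply: (@computable_ext (fun l => 1 - P l)); first by move=> l; case: (P l).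
computability.
Qed.

Lemma computable_andb : computable (fun l => P l && Q l).
Proof.
apply: (@computable_ext (fun l => P l * Q l)); last computability.
by move=> l; case: (P l) (Q l) => [] [].
Qed.

Lemma computable_orb : computable (fun l => P l || Q l).
Proof.
apply: (@computable_ext (fun l => 1 - (1 - P l) * (1 - Q l))); last computability.
by move=> l; case: (P l) (Q l) => [] [].
Qed.

Variables f g : seq nat -> nat.
Hypotheses (Hf : computable f) (Hg : computable g).

Lemma computable_if : computable (fun l => if P l then f l else g l).
Proof.
apply: (@computable_ext (fun l => P l * f l + (1 - P l) * g l));
  last computability.
by move=> l; case: (P l); rewrite ?mul1n ?mul0n ?addn0.
Qed.

Lemma computable_leq : computable (fun l => f l <= g l).
Proof.
apply: (@computable_ext (fun l => 1 - (f l - g l))); last computability.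
by move=> l; lia.
Qed.

Lemma computable_eqn : computable (fun l => f l == g l).
Proof.
apply: (@computable_ext (fun l => 1 - ((f l - g l) + (g l - f l))));
  last computability.
by move=> l; lia.
Qed.

End Booleans.
#[global] Hint Resolve computable_negb computable_andb computable_orb
  computable_if computable_leq computable_eqn : computable.

Lemma computable_all (n : seq nat -> nat) (P : nat -> seq nat -> bool) :
  computable n -> computable (fun l => P (nth 0 l 0) (drop 2 l)) ->
  computable (fun l => all (fun k => P k l) (iota 0 (n l))).
Proof.
move=> Hn HP.
apply: (computable_ext _ (computable_foldr (b := fun k acc l => P k l * acc)
  Hn (computable_const 1) _)); last computability.
by move=> l; elim: (iota 0 _) => //= k s ->; case: (P k l); rewrite ?mul1n.
Qed.

(** Quotients and square roots are found by counting the candidates that are not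
    too large. *)
Lemma sum_initial (P : nat -> bool) q n :
  (forall k, P k = (k < q)) -> q <= n -> \sum_(k <- iota 0 n) P k = q.
Proof.
move=> HP le_qn; rewrite -(subnKC le_qn) iotaD big_cat /= add0n.
rewrite [X in X + _](eq_big_seq (fun=> 1)); last first.
  by move=> k; rewrite mem_iota HP; lia.
rewrite [X in _ + X]big1_seq; last first.
  by move=> k; rewrite mem_iota HP; lia.
by rewrite big_const_seq count_predT size_iota iter_addn_0 mul1n addn0.
Qed.

Section Division.
Variables f g : seq nat -> nat.
Hypotheses (Hf : computable f) (Hg : computable g).

Lemma computable_divn : computable (fun l => f l %/ g l).
Proof.
apply: (@computable_ext (fun l =>
  (0 < g l) * \sum_(k <- iota 0 (f l)) (k.+1 * g l <= f l))).
  move=> l; case: (posnP (g l)) => [->|g0]; first by rewrite divn0.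
  rewrite mul1n; apply: sum_initial; last exact: leq_div.
  by move=> k; rewrite leq_divRL.
have := computable_sum (F := fun k l => (k.+1 * g l <= f l)) Hf.
move=> H; have {}H : computable _ := H ltac:(computability).
computability.
Qed.

End Division.
#[global] Hint Resolve computable_divn : computable.

Section Remainder.
Variables f g : seq nat -> nat.
Hypotheses (Hf : computable f) (Hg : computable g).

Lemma computable_modn : computable (fun l => f l %% g l).
Proof.
apply: (@computable_ext (fun l => f l - f l %/ g l * g l)); last computability.
by move=> l; rewrite {1}(divn_eq (f l) (g l)) addKn.
Qed.

End Remainder.
#[global] Hint Resolve computable_modn : computable.

Lemma computable_odd f : computable f -> computable (fun l => odd (f l)).
Proof.
move=> Hf; apply: (@computable_ext (fun l => f l %% 2)); last computability.
by move=> l; rewrite modn2.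
Qed.
#[global] Hint Resolve computable_odd : computable.

(** Any finite table is computable, whatever its entries: this is how the
    transition function of an arbitrary machine enters a program. *)
Lemma computable_table (T : nat -> nat) N f : computable f ->
  computable (fun l => if f l < N then T (f l) else 0).
Proof.
move=> Hf; elim: N => [|N IH]; first by apply: computable_ext computable0.
apply: (@computable_ext (fun l => if f l == N then T N else
   if f l < N then T (f l) else 0)); last computability.
by move=> l; rewrite ltnS [in RHS]leq_eqVlt; case: eqP => [->|].
Qed.

(** The root of [(a + b) ^ 2 + a] is [a + b], because
    [a < (a + b).*2.+1]. *)
Definition pairn a b := (a + b) ^ 2 + a.
Definition isqrt z := \sum_(k <- iota 0 z) (k.+1 ^ 2 <= z).
Definition fstn z := z - isqrt z ^ 2.
Definition sndn z := isqrt z - fstn z.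

Lemma isqrt_pair a b : isqrt (pairn a b) = a + b.
Proof.
apply: sum_initial; rewrite /pairn; last by nia.
move=> k; apply/idP/idP; nia.
Qed.

Lemma pairnK1 a b : fstn (pairn a b) = a.
Proof. by rewrite /fstn isqrt_pair /pairn addKn. Qed.

Lemma pairnK2 a b : sndn (pairn a b) = b.
Proof. by rewrite /sndn pairnK1 isqrt_pair addKn. Qed.

Section Pairs.
Variables f g : seq nat -> nat.
Hypotheses (Hf : computable f) (Hg : computable g).

Lemma computable_pairn : computable (fun l => pairn (f l) (g l)).
Proof. by rewrite /pairn; computability. Qed.

Lemma computable_isqrt : computable (fun l => isqrt (f l)).
Proof.
apply: (computable_sum (F := fun k l => k.+1 ^ 2 <= f l)); first by [].
computability.
Qed.

End Pairs.
#[global] Hint Resolve computable_pairn computable_isqrt : computable.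

Lemma computable_fstn f : computable f -> computable (fun l => fstn (f l)).
Proof. by move=> Hf; rewrite /fstn; computability. Qed.
#[global] Hint Resolve computable_fstn : computable.

Lemma computable_sndn f : computable f -> computable (fun l => sndn (f l)).
Proof. by move=> Hf; rewrite /sndn; computability. Qed.
#[global] Hint Resolve computable_sndn : computable.

(** * Turing machine runs are computable *)

Section Simulation.
Variables (A : finType) (M : turing_machine A).
Implicit Types (u l r : seq (tm_symbol M)) (x y : tm_symbol M) (q : tm_state M).

(** The blank has code 0, so that the cells beyond the end of a list agree with
    the digits beyond the end of a number. *)
Definition sym_code x : nat := if x is Some y then (enum_rank y).+1 else 0.
Definition sym_base := #|{: A + tm_aux M}|.+1.

Lemma sym_code_lt x : sym_code x < sym_base.
Proof. by case: x => //= y; rewrite ltnS ltn_ord. Qed.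

Lemma sym_code_inj : injective sym_code.
Proof.
by move=> [x|] [y|] //= [] /ord_inj /enum_rank_inj ->.
Qed.

(** Codes 0 and 1 are left to the two answers. *)
Definition state_code q : nat := (enum_rank q).+2.

Lemma state_code_inj : injective state_code.
Proof. by move=> q q' [] /ord_inj /enum_rank_inj. Qed.

Definition tape_push x a := sym_code x + sym_base * a.
Definition tape_code u := foldr tape_push 0 u.

Lemma tape_code_mod u : tape_code u %% sym_base = sym_code (head None u).
Proof.
case: u => [|x u] /=; first by rewrite mod0n.
by rewrite /tape_push addnC mulnC modnMDl modn_small ?sym_code_lt.
Qed.

Lemma tape_code_div u : tape_code u %/ sym_base = tape_code (behead u).
Proof.
case: u => [|x u] /=; first by rewrite div0n.
by rewrite /tape_push addnC mulnC divnMDl // divn_small ?sym_code_lt ?addn0.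
Qed.

Definition config_code (c : tm_config M) :=
  pairn (state_code (cfg_state c))
    (pairn (tape_code (cfg_left c)) (tape_code (cfg_right c))).

Definition move_code (m : tape_move) :=
  match m with MoveLeft => 0 | MoveRight => 1 | Stay => 2 end.

Definition action_code (a : (tm_state M * tm_symbol M * tape_move) + bool) :=
  match a with
  | inl (q, x, m) => pairn (state_code q) (pairn (sym_code x) (move_code m))
  | inr b => pairn b 0
  end.

Definition action_table (i : nat) : nat :=
  match [pick q | state_code q == i %/ sym_base],
        [pick x | sym_code x == i %% sym_base] with
  | Some q, Some x => action_code (tm_trans q x)
  | _, _ => 0
  end.

Lemma action_tableE q x :
  action_table (state_code q * sym_base + sym_code x) =
  action_code (tm_trans q x).
Proof.
rewrite /action_table divnMDl // divn_small ?sym_code_lt // addn0.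
rewrite modnMDl modn_small ?sym_code_lt //.
case: pickP => [q' /eqP /state_code_inj->|/(_ q)]; last by rewrite eqxx.
by case: pickP => [x' /eqP /sym_code_inj->|/(_ x)] //; rewrite eqxx.
Qed.

Definition action_bound := (#|tm_state M|).+2 * sym_base.

Lemma action_bound_lt q x :
  state_code q * sym_base + sym_code x < action_bound.
Proof.
apply: (@leq_trans ((state_code q).+1 * sym_base)).
  by rewrite mulSn addnC ltn_add2r sym_code_lt.
by rewrite leq_mul2r !ltnS ltn_ord orbT.
Qed.

Definition step_code (z : nat) : nat :=
  let c := fstn z in
  let l := fstn (sndn z) in
  let r := sndn (sndn z) in
  let i := c * sym_base + r %% sym_base in
  let o := if i < action_bound then action_table i else 0 in
  let r' := fstn (sndn o) + sym_base * (r %/ sym_base) in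
  if c <= 1 then z
  else if fstn o <= 1 then pairn (fstn o) 0
  else pairn (fstn o)
    (if sndn (sndn o) == 0 then
       pairn (l %/ sym_base) (l %% sym_base + sym_base * r')
     else if sndn (sndn o) == 1 then
       pairn (fstn (sndn o) + sym_base * l) (r %/ sym_base)
     else pairn l r').

Lemma step_codeE c :
  step_code (config_code c) =
  match tm_step c with
  | inl c' => config_code c'
  | inr b => pairn b 0
  end.
Proof.
case: c => q l r; rewrite /step_code /config_code !(pairnK1, pairnK2) /=.
rewrite tape_code_mod action_bound_lt action_tableE /tm_step /=.
case: tm_trans => [[[q' x] m]|b] /=; last first.
  by rewrite pairnK1; case: b.
rewrite !(pairnK1, pairnK2) !tape_code_div tape_code_mod /=.
by case: m => /=; rewrite /tape_push.
Qed.

Lemma step_code_answer (b : bool) t : iter t step_code (pairn b 0) = pairn b 0.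
Proof.
by elim: t => //= t ->; rewrite /step_code pairnK1 /=; case: b.
Qed.

(** After an answer the code is a fixed point of [step_code], so the number of
    rounds can be any number that is large enough. *)
Lemma run_code t c :
  (fstn (iter t step_code (config_code c)) == 1) = (tm_run t c == Some true).
Proof.
elim: t c => [|t IH] c /=; first by rewrite pairnK1.
rewrite -iterS iterSr step_codeE; case: tm_step => [c'|b]; first exact: IH.
by rewrite step_code_answer pairnK1; case: b.
Qed.

Lemma computable_run f g : computable f -> computable g ->
  computable (fun v => fstn (iter (g v) step_code
    (pairn (state_code (tm_start M)) (pairn 0 (f v)))) == 1).
Proof.
move=> Hf Hg.
have Hstep z : computable z -> computable (fun v => step_code (z v)).
  move=> Hz; have : computable (fun v => let i := fstn (z v) * sym_base +
      sndn (sndn (z v)) %% sym_base in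
      if i < action_bound then action_table i else 0).
    by apply: computable_table; computability.
  by rewrite /step_code; cbv zeta => Ht; computability.
suff H : computable (fun v => iter (g v) step_code
    (pairn (state_code (tm_start M)) (pairn 0 (f v)))) by computability.
apply: (computable_ext _ (computable_foldr
  (b := fun _ acc _ => step_code acc) Hg
  (a := fun v => pairn (state_code (tm_start M)) (pairn 0 (f v))) _ _)).
- move=> v; rewrite -[in RHS](size_iota 0 (g v)).
  by elim: (iota 0 _) => //= k s ->.
- by computability.
- apply: Hstep; computability.
Qed.

End Simulation.

(** * The walk attached to a table *)

(** Coordinates are addressed by their position, counted from the last one, so
    that a face is a binary numeral and a jump a ternary numeral with digit [k] at
    position [k]; the digits 0, 1, 2 of a jump stand for -1, 0, 1.  From low to
    high positions the walk has [d0] core coordinates, which run a program, [n]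
    loader coordinates, a clock, and the alive flag.  A face is given to the
    functions below by its digits. *)

Definition digit b m k := m %/ b ^ k %% b.

Definition core_index d0 (b : nat -> bool) := \sum_(k <- iota 0 d0) b k * 2 ^ k.

Definition start_trit d0 k := if (d0 <= k) || (k == 2) then 2 else 1.

Definition drain_trit (b : nat -> bool) k := if b k then 0 else 1.

(** The loader coordinates are all 1 at the start and are cleared from the top,
    one per step, while the core coordinate at position 1, which is register 0,
    goes up to [n]: the number of loader coordinates is the input of the program.  A step is a loading step
    exactly when the lowest loader coordinate is still positive.  Afterwards the
    jump of the core is read in the table [F], whose row is the face of the
    core. *)
Definition step_trit d0 F n (b : nat -> bool) k :=
  if k == (d0 + n).+1 then 1
  else if k == d0 + n then 2
  else if b d0 then
    if k < d0 then (if k == 1 then 2 else 1)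
    else if b k && ((k.+1 == d0 + n) || ~~ b k.+1) then 0 else 1
  else if k < d0 then digit 3 F (core_index d0 b * d0 + k) else 1.

Lemma digit_lt b m k : 0 < b -> digit b m k < b.
Proof. exact: ltn_pmod. Qed.

Lemma start_trit_lt d0 k : start_trit d0 k < 3.
Proof. by rewrite /start_trit; case: ifP. Qed.

Lemma drain_trit_lt b k : drain_trit b k < 3.
Proof. by rewrite /drain_trit; case: ifP. Qed.

Lemma step_trit_lt d0 F n b k : step_trit d0 F n b k < 3.
Proof. by rewrite /step_trit; do !case: ifP => // _; apply: digit_lt. Qed.

Section Faces.
Variable d : nat.

Definition face_bit (L : {set 'I_d.+1}) (k : nat) : bool :=
  (k <= d) && (inord (d - k) \in L).

Definition jump_of (t : nat -> nat) : jump d.+1 :=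
  [ffun i : 'I_d.+1 => inord (t (d - i))].

Definition drain (L : {set 'I_d.+1}) : jump d.+1 :=
  jump_of (drain_trit (face_bit L)).

Section Weight.
Variables (start : jump d.+1) (step : {set 'I_d.+1} -> jump d.+1).

(** Twice the transition probability, so that it is a natural number.  A live
    state dies with probability 1/2; a state that is dead, or halted as shown by
    the coordinate at position 0, drains: each positive coordinate goes down by 1
    until the origin is reached. *)
Definition killed_weight (L : {set 'I_d.+1}) (D : jump d.+1) : nat :=
  if L == finset.set0 then 2 * (D == start)
  else if (ord0 \in L) && ~~ face_bit L 0 then (D == step L) + (D == drain L)
  else 2 * (D == drain L).

Definition killed_walk : transition_table d.+1 :=
  fun L D => ((killed_weight L D)%:R / 2)%R.

End Weight.

Definition index_face (i : nat) : {set 'I_d.+1} :=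
  [set x : 'I_d.+1 | odd (i %/ 2 ^ (d - x))].

Definition index_jump (j : nat) : jump d.+1 :=
  [ffun x : 'I_d.+1 => inord (digit 3 j (d - x))].

Lemma face_bit_index i k : i < 2 ^ d.+1 ->
  face_bit (index_face i) k = odd (i %/ 2 ^ k).
Proof.
move=> lt_i; rewrite /face_bit; case: leqP => [le_k|lt_k] /=.
  by rewrite inE inordK ?subKn // ltnS leq_subr.
by rewrite divn_small // (leq_trans lt_i) // leq_exp2l.
Qed.

Lemma index_jump_eq t j : (forall k, t k < 3) ->
  (index_jump j == jump_of t) = all (fun k => digit 3 j k == t k) (iota 0 d.+1).
Proof.
move=> lt_t; apply/eqP/allP => [E k|H].
  rewrite mem_iota add0n ltnS /= => le_k.
  move/ffunP: E => /(_ (inord (d - k))); rewrite !ffunE inordK ?ltnS ?leq_subr //.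
  rewrite subKn // => /(congr1 val); rewrite /= !inordK ?lt_t ?digit_lt //.
  by move->.
apply/ffunP => x; rewrite !ffunE; congr inord; apply/eqP/H.
by rewrite mem_iota add0n ltnS leq_subr.
Qed.

Lemma index_face_eq0 i : i < 2 ^ d.+1 -> (index_face i == finset.set0) = (i == 0).
Proof.
move=> lt_i; apply/eqP/eqP => [E|->]; last first.
  by apply/setP => x; rewrite !inE div0n.
apply/eqP; rewrite -leqn0 leqNgt; apply/negP => i0.
have le_k : trunc_log 2 i <= d.
  by rewrite -ltnS -(ltn_exp2l _ _ (isT : 1 < 2)) (leq_ltn_trans _ lt_i)
    ?trunc_logP.
have /setP/(_ (inord (d - trunc_log 2 i))) := E.
rewrite !inE inordK ?ltnS ?leq_subr // subKn //.
have -> // : i %/ 2 ^ trunc_log 2 i = 1.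
have /andP[le1 lt1] := trunc_log_bounds (isT : 1 < 2) i0.
apply/eqP; rewrite eqn_leq -ltnS ltn_divLR ?expn_gt0 // leq_divRL ?expn_gt0 //.
by rewrite mul1n le1 -expnS lt1.
Qed.

End Faces.

(** * Faces and jumps in the order of their indices *)

Lemma allpairs_iota T (f : nat -> nat -> T) a b :
  [seq f x y | x <- iota 0 a, y <- iota 0 b] =
  [seq f (m %/ b) (m %% b) | m <- iota 0 (a * b)].
Proof.
elim: a => // a IH; rewrite -addn1 iotaD allpairs_cat {}IH.
rewrite mulnDl mul1n iotaD map_cat /= cats0; congr (_ ++ _).
rewrite !add0n -[in RHS](addn0 (a * b)) iotaDl -map_comp.
apply/eq_in_map => y; rewrite mem_iota => /andP[_ lt_y] /=.
by rewrite divnMDl ?modnMDl ?divn_small ?modn_small ?addn0 //;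
  apply: leq_ltn_trans lt_y.
Qed.

Lemma words_map (T U : Type) (f : T -> U) s n :
  words (map f s) n = map (map f) (words s n).
Proof.
elim: n => //= n ->; rewrite allpairs_mapl allpairs_mapr map_allpairs.
by [].
Qed.

Lemma words_iota b n : 0 < b ->
  words (iota 0 b) n =
  [seq mkseq (fun k => digit b i (n - k.+1)) n | i <- iota 0 (b ^ n)].
Proof.
move=> b0; elim: n => [|n IH] //=.
rewrite IH allpairs_mapr allpairs_iota expnS.
apply/eq_in_map => m; rewrite mem_iota add0n => /andP[_ lt_m].
rewrite /mkseq /= subn1 /=; congr cons.
  by rewrite /digit modn_small // ltn_divLR ?expn_gt0 ?b0.
rewrite -[1]/(1 + 0) iotaDl -map_comp; apply/eq_in_map => k.
rewrite mem_iota add0n => /andP[_ lt_k] /=; rewrite /digit add1n subSS.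
by rewrite ?subSS !modn_divl -expnS modn_dvdm // dvdn_exp2l //; lia.
Qed.

Lemma all_facesE d :
  all_faces d.+1 = [seq index_face d i | i <- iota 0 (2 ^ d.+1)].
Proof.
rewrite /all_faces -[[:: false; true]]/(map odd (iota 0 2)) words_map
  words_iota //.
rewrite -!map_comp; apply/eq_in_map => i _; rewrite /comp; apply/setP => x.
rewrite !inE (nth_map 0) ?size_mkseq // nth_mkseq // subSS.
by rewrite /digit modn2 oddb.
Qed.

Lemma all_jumpsE d :
  all_jumps d.+1 = [seq index_jump d i | i <- iota 0 (3 ^ d.+1)].
Proof.
have -> : all_jumps d.+1 = [seq [ffun i : 'I_d.+1 => nth ord0 u i] |
    u <- words (map inord (iota 0 3)) d.+1].
  rewrite /all_jumps; congr (map _ (words _ _)).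
  by apply: (inj_map val_inj); rewrite val_enum_ord /= !inordK.
rewrite words_map words_iota //.
rewrite -!map_comp; apply/eq_in_map => i _; rewrite /comp; apply/ffunP => x.
by rewrite !ffunE (nth_map 0) ?size_mkseq // nth_mkseq // subSS.
Qed.

Section Instance.
Variables d0 F n : nat.

Definition table_start : jump (d0 + n).+2 := jump_of _ (start_trit d0).

Definition table_step (L : {set 'I_(d0 + n).+2}) : jump (d0 + n).+2 :=
  jump_of _ (step_trit d0 F n (face_bit L)).

Definition table_walk : transition_table (d0 + n).+2 :=
  killed_walk table_start table_step.

(** A step raises at most the [(d0 + n).+1] coordinates other than the alive flag,
    so the weight [(d0 + n).+2] of the flag makes up for it when the walk dies. *)
Definition table_weight (i : 'I_(d0 + n).+2) : rat :=
  if i == ord0 then (d0 + n).+2%:R%R else 1%R.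

(** The bound 1/4 is the stationary probability of the origin when the program
    never halts. *)
Definition table_instance : walk_instance :=
  @WalkInstance (d0 + n).+2 table_walk table_weight (1 / 4)%R.

(** Stated with digits of indices only, so that it is visibly computable. *)
Definition weight_code i j : nat :=
  if i == 0 then
    2 * all (fun k => digit 3 j k == start_trit d0 k) (iota 0 (d0 + n).+2)
  else if odd (i %/ 2 ^ (d0 + n).+1) && ~~ odd (i %/ 2 ^ 0) then
    all (fun k => digit 3 j k ==
      step_trit d0 F n (fun k' => odd (i %/ 2 ^ k')) k) (iota 0 (d0 + n).+2)
    + all (fun k => digit 3 j k == drain_trit (fun k' => odd (i %/ 2 ^ k')) k)
        (iota 0 (d0 + n).+2)
  else 2 *
    all (fun k => digit 3 j k == drain_trit (fun k' => odd (i %/ 2 ^ k')) k)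
        (iota 0 (d0 + n).+2).

Lemma step_trit_ext b b' k :
  b =1 b' -> step_trit d0 F n b k = step_trit d0 F n b' k.
Proof.
move=> E; rewrite /step_trit !E; have -> // : core_index d0 b = core_index d0 b'.
by apply: eq_bigr => k' _; rewrite E.
Qed.

Lemma weight_codeE i j : i < 2 ^ (d0 + n).+2 ->
  weight_code i j =
  killed_weight table_start table_step (index_face _ i) (index_jump _ j).
Proof.
move=> lt_i; have E k := face_bit_index k lt_i.
rewrite /killed_weight index_face_eq0 // /weight_code.
rewrite {1}/index_face inE subn0 E /drain /table_step /table_start !index_jump_eq;
  try by [exact: start_trit_lt | exact: step_trit_lt | exact: drain_trit_lt].
have E2 : all (fun k => digit 3 j k == drain_trit (fun k' => odd (i %/ 2 ^ k')) k)
    (iota 0 (d0 + n).+2) = all (fun k => digit 3 j k ==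
      drain_trit (face_bit (index_face (d0 + n).+1 i)) k) (iota 0 (d0 + n).+2).
  by apply: eq_all => k; rewrite /drain_trit E.
rewrite -E2.
case: (i == 0) => //; case: (_ && _) => //; congr (nat_of_bool _ + _).
by apply: eq_all => k; congr (_ == _); apply: step_trit_ext => k'; rewrite E.
Qed.

End Instance.

(** * The encoding of the instance is computable *)

Section Encoding.
Variable M : turing_machine letter.

(** Words are pushed in front of a tape that is already coded, so the whole
    encoding is built from its last letter to its first, in the order of a
    [foldr]. *)
Definition push_letter (x : letter) (a : nat) : nat :=
  @tape_push _ M (Some (inl x)) a.

Definition push_word (u : seq letter) (a : nat) : nat := foldr push_letter a u.

Lemma push_wordE u : @tape_code _ M [seq Some (inl a) | a <- u] = push_word u 0.
Proof. by rewrite /tape_code foldr_map. Qed.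

Lemma push_word_cat u v a : push_word (u ++ v) a = push_word u (push_word v a).
Proof. exact: foldr_cat. Qed.

Lemma push_word_flatten (T : Type) (f : T -> seq letter) s a :
  push_word (flatten [seq f x | x <- s]) a =
  foldr (fun x acc => push_word (f x) acc) a s.
Proof. by elim: s => //= x s IH; rewrite push_word_cat IH. Qed.

Lemma computable_push_letter x f :
  computable f -> computable (fun l => push_letter x (f l)).
Proof. by move=> Hf; rewrite /push_letter /tape_push; computability. Qed.
#[local] Hint Resolve computable_push_letter : computable.

Lemma computable_push_word u f :
  computable f -> computable (fun l => push_word u (f l)).
Proof. by move=> Hf; elim: u => [|x u IH] //=; computability. Qed.
#[local] Hint Resolve computable_push_word : computable.

Definition push_nat (m a : nat) : nat :=
  foldr (fun k acc => if 2 ^ k <= m then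
      if odd (m %/ 2 ^ k) then push_letter (Some true) acc
      else push_letter (Some false) acc
    else acc) (push_letter None a) (iota 0 m).

(** Digit [k] of [m] is written when [2 ^ k <= m], and every such [k] is below
    [m]: the loop can run up to [m] instead of the number of digits. *)
Lemma push_natE m a : push_nat m a = push_word (encode_nat m) a.
Proof.
rewrite /push_word /encode_nat foldr_rcons foldr_map /push_nat.
move: (push_letter None a) => {}a.
have Hle k : (2 ^ k <= m) = (k < up_log 2 m.+1).
  apply/idP/idP => H.
    rewrite -(ltn_exp2l _ _ (isT : 1 < 2)).
    exact: leq_ltn_trans H (up_logP _ (isT : 1 < 2)).
  rewrite leqNgt; apply/negP => lt_m.
  by have := up_log_min (isT : 1 < 2) lt_m; rewrite leqNgt H.
have le_m : up_log 2 m.+1 <= m.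
  by apply: up_log_min => //; apply: ltn_expl.
have -> : iota 0 m =
    iota 0 (up_log 2 m.+1) ++ iota (up_log 2 m.+1) (m - up_log 2 m.+1).
  by rewrite -iotaD subnKC.
rewrite foldr_cat.
set z := foldr _ a (iota _ (m - _)).
have -> : z = a.
  rewrite /z; have : all (fun k => up_log 2 m.+1 <= k)
      (iota (up_log 2 m.+1) (m - up_log 2 m.+1)).
    by apply/allP => k; rewrite mem_iota => /andP[].
  by elim: (iota _ _) => //= k s IH /andP[le_k /IH->]; rewrite Hle ltnNge le_k.
have : all (fun k => k < up_log 2 m.+1) (iota 0 (up_log 2 m.+1)).
  by apply/allP => k; rewrite mem_iota add0n => /andP[].
elim: (iota 0 _) => //= k s IH /andP[lt_k /IH->].
by rewrite Hle lt_k; case: odd.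
Qed.

Lemma computable_push_nat f g : computable f -> computable g ->
  computable (fun l => push_nat (f l) (g l)).
Proof.
move=> Hf Hg.
apply: (computable_foldr (b := fun k acc l => if 2 ^ k <= f l then
      if odd (f l %/ 2 ^ k) then push_letter (Some true) acc
      else push_letter (Some false) acc
    else acc)); computability.
Qed.
#[local] Hint Resolve computable_push_nat : computable.

Definition push_weight (v a : nat) : nat :=
  if v == 0 then push_word (encode_rat 0%R) a
  else if v == 1 then push_word (encode_rat (1 / 2)%R) a
  else push_word (encode_rat 1%R) a.

Definition instance_code (d0 F n : nat) : nat :=
  push_nat (d0 + n).+2
    (foldr (fun m acc =>
        push_weight (weight_code d0 F n
          (m %/ 3 ^ (d0 + n).+2) (m %% 3 ^ (d0 + n).+2)) acc)
      (push_letter (Some false) (push_nat (d0 + n).+2 (push_word (encode_nat 1)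
        (foldr (fun _ acc => push_word (encode_rat 1%R) acc)
          (push_word (encode_rat (1 / 4)%R) 0)
          (iota 0 (d0 + n).+1)))))
      (iota 0 (2 ^ (d0 + n).+2 * 3 ^ (d0 + n).+2))).

Lemma killed_weight_le2 d start step L D : @killed_weight d start step L D <= 2.
Proof.
rewrite /killed_weight; case: (D == start); case: (D == step L);
  case: (D == drain L); by do !case: ifP.
Qed.

Lemma push_weightE v a : v <= 2 ->
  push_weight v a = push_word (encode_rat (v%:R / 2)%R) a.
Proof.
rewrite /push_weight; case: v => [|[|[|]]] // _ /=;
  do ?by congr (push_word (encode_rat _)).
Qed.

Lemma encode_rat_nat m :
  encode_rat m%:R%R = Some false :: encode_nat m ++ encode_nat 1.
Proof.
rewrite /encode_rat -[(m%:R : rat)%R]/(m%:~R)%R numq_int denq_int /=.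
by rewrite /encode_int.
Qed.

Lemma table_weight_words d0 n :
  [seq encode_rat (table_weight i) | i <- enum 'I_(d0 + n).+2] =
  encode_rat (d0 + n).+2%:R%R :: [seq encode_rat 1%R | _ <- iota 0 (d0 + n).+1].
Proof.
rewrite enum_ordSl map_cons -map_comp; congr cons.
by rewrite -val_enum_ord -map_comp; apply: eq_map => x; rewrite /comp.
Qed.

Lemma instance_codeE d0 F n :
  @tape_code _ M
    [seq Some (inl a) | a <- encode_walk_instance (table_instance d0 F n)]
  = instance_code d0 F n.
Proof.
rewrite push_wordE /encode_walk_instance !push_word_cat -push_natE.
rewrite /instance_code; congr push_nat.
rewrite /wi_dim /wi_p /wi_w /wi_r /table_instance all_facesE all_jumpsE.
rewrite allpairs_mapl allpairs_mapr allpairs_iota table_weight_words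
  encode_rat_nat.
have flatten_cons (x : seq letter) s : flatten (x :: s) = x ++ flatten s by [].
rewrite flatten_cons push_word_cat push_word_flatten.
rewrite -[push_word (_ :: _) _]/(push_letter (Some false) (push_word _ _)).
rewrite push_word_cat -push_natE push_word_flatten.
move: (push_letter _ _) => a.
have : all (fun m => m < 2 ^ (d0 + n).+2 * 3 ^ (d0 + n).+2)
    (iota 0 (2 ^ (d0 + n).+2 * 3 ^ (d0 + n).+2)).
  by apply/allP => m; rewrite mem_iota add0n => /andP[].
elim: (iota 0 _) => // m s IH /andP[lt_m /IH E].
rewrite [LHS]/= [RHS]/= E weight_codeE; last by rewrite ltn_divLR ?expn_gt0.
by rewrite push_weightE ?killed_weight_le2.
Qed.

Lemma computable_digit b f g : computable f -> computable g ->
  computable (fun l => digit b (f l) (g l)).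
Proof. by move=> Hf Hg; rewrite /digit; computability. Qed.
#[local] Hint Resolve computable_digit : computable.

Section Computable.
Variables d0 F n i j k : seq nat -> nat.
Hypotheses (Hd0 : computable d0) (HF : computable F) (Hn : computable n)
  (Hi : computable i) (Hj : computable j) (Hk : computable k).

Lemma computable_core_index :
  computable (fun l => core_index (d0 l) (fun k' => odd (i l %/ 2 ^ k'))).
Proof.
apply: (computable_sum (F := fun k' l => odd (i l %/ 2 ^ k') * 2 ^ k')) => //.
computability.
Qed.

Lemma computable_start_trit : computable (fun l => start_trit (d0 l) (k l)).
Proof. by rewrite /start_trit; computability. Qed.

Lemma computable_drain_trit :
  computable (fun l => drain_trit (fun k' => odd (i l %/ 2 ^ k')) (k l)).
Proof. by rewrite /drain_trit; computability. Qed.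

Lemma computable_step_trit : computable (fun l =>
  step_trit (d0 l) (F l) (n l) (fun k' => odd (i l %/ 2 ^ k')) (k l)).
Proof. by have H := computable_core_index; rewrite /step_trit; computability. Qed.

End Computable.
#[local] Hint Resolve computable_start_trit computable_drain_trit
  computable_step_trit : computable.

Section Computable2.
Variables d0 F n i j : seq nat -> nat.
Hypotheses (Hd0 : computable d0) (HF : computable F) (Hn : computable n)
  (Hi : computable i) (Hj : computable j).

Lemma computable_weight_code :
  computable (fun l => weight_code (d0 l) (F l) (n l) (i l) (j l)).
Proof.
have Hd : computable (fun l => (d0 l + n l).+2) by computability.
have H1 := computable_all (P := fun k l =>
  digit 3 (j l) k == start_trit (d0 l) k) Hd.
have {}H1 := H1 ltac:(computability).
have H2 := computable_all (P := fun k l => digit 3 (j l) k ==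
  step_trit (d0 l) (F l) (n l) (fun k' => odd (i l %/ 2 ^ k')) k) Hd.
have {}H2 := H2 ltac:(computability).
have H3 := computable_all (P := fun k l => digit 3 (j l) k ==
  drain_trit (fun k' => odd (i l %/ 2 ^ k')) k) Hd.
have {}H3 := H3 ltac:(computability).
by rewrite /weight_code; computability.
Qed.

Lemma computable_push_weight : computable (fun l => push_weight (i l) (j l)).
Proof. by rewrite /push_weight; computability. Qed.

End Computable2.
#[local] Hint Resolve computable_weight_code computable_push_weight : computable.

Lemma computable_instance_code d0 F n :
  computable d0 -> computable F -> computable n ->
  computable (fun l => instance_code (d0 l) (F l) (n l)).
Proof.
move=> Hd0 HF Hn.
have Hd : computable (fun l => (d0 l + n l).+2) by computability.
have H1 : computable (fun l => foldr (fun _ acc => push_word (encode_rat 1%R) acc)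
          (push_word (encode_rat (1 / 4)%R) 0) (iota 0 (d0 l + n l).+1)).
  apply: (computable_foldr (b := fun _ acc _ => push_word (encode_rat 1%R) acc)
    (a := fun=> _)); computability.
rewrite /instance_code; apply: computable_push_nat => //.
apply: (computable_foldr (b := fun m acc l => push_weight
  (weight_code (d0 l) (F l) (n l) (m %/ 3 ^ (d0 l + n l).+2)
     (m %% 3 ^ (d0 l + n l).+2)) acc)).
- by computability.
- by computability.
- by computability.
Qed.

End Encoding.

(** * Flow charts as tables of jumps *)

Lemma core_index_recl d b :
  core_index d.+1 b = b 0 + 2 * core_index d (fun k => b k.+1).
Proof.
rewrite /core_index /= big_cons expn0 muln1 big_distrr /=; congr addn.
rewrite -[1]/(1 + 0) iotaDl big_map; apply: eq_bigr => k _.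
by rewrite add1n expnS mulnCA.
Qed.

Lemma core_index_bit d b k : k < d -> odd (core_index d b %/ 2 ^ k) = b k.
Proof.
elim: d b k => // d IH b [|k] lt_k; rewrite core_index_recl.
  by rewrite divn1 oddD oddM /= addbF oddb.
rewrite expnS divnMA [_ + _]addnC mulnC divnMDl //.
by rewrite [b 0 %/ 2]divn_small ?addn0 ?IH //; case: (b 0).
Qed.

Lemma core_index_lt d b : core_index d b < 2 ^ d.
Proof.
elim: d b => [|d IH] b; first by rewrite /core_index big_nil.
have := IH (fun k => b k.+1); rewrite core_index_recl expnS.
by case: (b 0); lia.
Qed.

Lemma exists_digits (f : nat -> nat) N : (forall x, f x < 3) ->
  exists F, forall x, x < N -> digit 3 F x = f x.
Proof.
elim: N f => [|N IH] f Hf; first by exists 0.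
have [|F HF] := IH (fun x => f x.+1); first by move=> x; apply: Hf.
exists (F * 3 + f 0) => -[|x] lt_x; rewrite /digit.
  by rewrite divn1 modnMDl modn_small.
by rewrite expnS divnMA divnMDl // (divn_small (Hf 0)) addn0 -HF.
Qed.

Section Core.
Variables (P : seq instr) (N : nat).

Definition instr_bounded (i : instr) :=
  match i with
  | IJmp t => t < N
  | IInc r t => (r < N) && (t < N)
  | IDec r t t' => [&& r < N, t < N & t' < N]
  end.

Hypotheses (N_gt1 : 1 < N) (P_bounded : all instr_bounded P).

Lemma nth_bounded k : instr_bounded (nth (IJmp 0) P k).
Proof.
have [lt_k|ge_k] := ltnP k (size P); last by rewrite nth_default //= ltnW.
exact: (all_nthP (IJmp 0) P_bounded).
Qed.

Definition core_pc (b : nat -> bool) := find (fun k => b k.*2) (iota 0 N).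

(** Register [r] is the coordinate at the odd position [r.*2.+1]; the program
    counter is a token among the even positions, a token at position 0 meaning
    that the program has halted.  The token starts at position 2, address 1.  On a
    face without a token nothing moves. *)
Definition core_trit (b : nat -> bool) (k : nat) : nat :=
  let pc := core_pc b in
  let goto t := 1 + (k == t.*2) - (k == pc.*2) in
  if pc < N then
    match nth (IJmp 0) P pc with
    | IJmp t => goto t
    | IInc r t => if odd k then 1 + (k == r.*2.+1) else goto t
    | IDec r t t' =>
        if odd k then 1 - (b k && (k == r.*2.+1))
        else goto (if b r.*2.+1 then t else t')
    end
  else 1.

Lemma core_trit_lt b k : core_trit b k < 3.
Proof.
rewrite /core_trit; case: ifP => // _; case: nth => *; do ?case: ifP => _;
  lia.
Qed.

Lemma core_trit0 b k : core_trit b k = 0 -> b k.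
Proof.
rewrite /core_trit; case: ifP => // lt_pc.
have b_pc : b (core_pc b).*2.
  have : has (fun k => b k.*2) (iota 0 N) by rewrite has_find size_iota.
  move/(nth_find 0).
  by rewrite -/(core_pc b) nth_iota // add0n.
have goto0 t : 1 + (k == t.*2) - (k == (core_pc b).*2) = 0 -> b k.
  by case: (eqVneq k (core_pc b).*2) => [->//|_]; lia.
case: nth => [t|r t|r t t']; first exact: goto0.
  by case: ifP => _; [lia | apply: goto0].
by case: ifP => _; [case: (b k) | apply: goto0].
Qed.

Lemma core_trit_ext b b' k : (forall j, j < N.*2 -> b j = b' j) -> k < N.*2 ->
  core_trit b k = core_trit b' k.
Proof.
move=> E lt_k; have Epc : core_pc b = core_pc b'.
  by apply: eq_in_find => j; rewrite mem_iota => /andP[_ lt_j]; apply: E; lia.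
rewrite /core_trit Epc E //.
have := nth_bounded (core_pc b'); case: nth => //= r t t' /andP[lt_r _].
by rewrite (E r.*2.+1) //; lia.
Qed.

(** Only finitely many pairs of a core face and a position matter, so one number
    holds the whole table. *)
Lemma exists_core_table : exists F, forall b k, k < N.*2 ->
  digit 3 F (core_index N.*2 b * N.*2 + k) = core_trit b k.
Proof.
have [|F HF] := exists_digits (f := fun x =>
  core_trit (fun k => odd (x %/ N.*2 %/ 2 ^ k)) (x %% N.*2)) (2 ^ N.*2 * N.*2).
  by move=> x; apply: core_trit_lt.
exists F => b k lt_k; rewrite HF.
  rewrite modnMDl modn_small // divnMDl 1?(divn_small lt_k) ?addn0; last by lia.
  by apply: core_trit_ext => // j lt_j; rewrite core_index_bit.
have := core_index_lt N.*2 b; set C := core_index _ _ => lt_C.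
apply: (@leq_trans (C.+1 * N.*2)); first by rewrite mulSn addnC ltn_add2r.
by rewrite leq_mul2r lt_C orbT.
Qed.

Definition core_value (c : flow_config) (k : nat) : nat :=
  if odd k then c.2 k./2 else k./2 == c.1.

Lemma flow_step_bounded c : c.1 < N -> (flow_step P c).1 < N.
Proof.
case: c => pc s /= lt_pc; have := nth_bounded pc; rewrite /flow_step.
case: nth => [t|r t|r t t'] //= => [/andP[]|/and3P[_ lt_t lt_t']] //.
by case: (s r).
Qed.

(** A jump read off the signs of the registers follows the flow chart, because an
    instruction tests nothing but a sign.  The shift by 1 is that of the digits
    of a jump. *)
Lemma core_valueS c k : c.1 < N ->
  core_value c k + core_trit (fun j => 0 < core_value c j) k =
  (core_value (flow_step P c) k).+1.
Proof.
case: c => pc s /= lt_pc.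
set b := fun j => _.
have b_even j : b j.*2 = (j == pc).
  by rewrite /b /core_value odd_double doubleK /=; case: eqP.
have b_odd j : b j.*2.+1 = (0 < s j).
  by rewrite /b /core_value /= odd_double /= uphalf_double.
have Epc : core_pc b = pc.
  rewrite /core_pc (eq_find (a2 := pred1 pc)) => [|j]; last exact: b_even.
  by rewrite -/(index pc _) -{1}[pc](nth_iota pc 0 lt_pc) ?add0n ?index_uniq
    ?size_iota ?iota_uniq.
rewrite /core_trit Epc lt_pc /flow_step.
have goto t : k = k./2.*2 -> core_value (pc, s) k +
    (1 + (k == t.*2) - (k == pc.*2)) = (k./2 == t).+1.
  move=> Ek; rewrite Ek /core_value odd_double doubleK /=.
  by rewrite -!muln2 !eqn_pmul2r //; case: (_ == pc); case: (_ == t).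
have := odd_double_half k; case: (boolP (odd k)) => [odd_k|even_k] /= Ek;
  last first.
  have Ev c : core_value c k = (k./2 == c.1).
    by rewrite /core_value (negbTE even_k).
  case: nth => [t|r t|r t t'] /=; rewrite goto ?Ev //.
  by rewrite b_odd; case: (s r).
have Ev c : core_value c k = c.2 k./2 by rewrite /core_value odd_k.
have Eodd r : (k == r.*2.+1) = (k./2 == r).
  by rewrite -{1}Ek add1n eqSS -!muln2 eqn_pmul2r.
have Eeven t : (k == t.*2) = false.
  by apply/negP => /eqP E; rewrite E odd_double in odd_k.
case: nth => [t|r t|r t t'] /=; rewrite !Ev /= ?Eeven ?Eodd; first by lia.
  by rewrite /upd; case: eqP => [->|_]; lia.
have -> : b k = (0 < s k./2) by rewrite -{1}Ek add1n b_odd.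
by rewrite /upd; case Er: (s r) => [|m] /=; case: eqP => [->|_];
  rewrite ?Er ?andbF; lia.
Qed.

End Core.

(** * The alive states follow the flow chart *)

Definition state_of d (X : nat -> nat) : walk_state d.+1 :=
  [ffun i : 'I_d.+1 => X (d - i)].

Lemma face_bit_state d X k :
  k <= d -> face_bit (face_of (state_of d X)) k = (0 < X k).
Proof.
move=> le_k; rewrite /face_bit le_k inE ffunE inordK ?subKn //.
by rewrite ltnS leq_subr.
Qed.

Lemma move_state d X X' t : (forall k, t k < 3) ->
  (forall k, k <= d -> X k + t k = (X' k).+1) ->
  move (state_of d X) (jump_of d t) = state_of d X'.
Proof.
move=> lt_t E; apply/ffunP => i; rewrite !ffunE /jump_coord inordK //.
by have := E _ (leq_subr i d); lia.
Qed.

Section Dynamics.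
Variables (P : seq instr) (N F n : nat).
Hypotheses (N_gt1 : 1 < N) (P_bounded : all (instr_bounded N) P) (n_gt0 : 0 < n).
Hypothesis F_table : forall b k, k < N.*2 ->
  digit 3 F (core_index N.*2 b * N.*2 + k) = core_trit P N b k.

Definition start_config (n : nat) : flow_config := (1, upd (fun=> 0) 0 n).

(** During the first [n] steps the program waits while register 0 is loaded. *)
Definition config_at g : flow_config :=
  iter (g - n) (flow_step P) (start_config (minn g n)).

Definition alive_value g k : nat :=
  if k == (N.*2 + n).+1 then 1
  else if k == N.*2 + n then g.+1
  else if k < N.*2 then core_value (config_at g) k
  else k - N.*2 < n - g.

Definition alive_state g := state_of (N.*2 + n).+1 (alive_value g).

Lemma config_at_bounded g : (config_at g).1 < N.
Proof.
by rewrite /config_at; elim: (g - n) => //= k; apply: flow_step_bounded.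
Qed.

Lemma alive_state0 : move (origin _) (table_start N.*2 n) = alive_state 0.
Proof.
rewrite (_ : origin _ = state_of (N.*2 + n).+1 (fun=> 0)); last first.
  by apply/ffunP => i; rewrite !ffunE.
apply: move_state => [|k le_k]; first exact: start_trit_lt.
rewrite /alive_value /start_trit subn0 /config_at sub0n min0n /=.
case: (ltnP k N.*2) => [lt_k|ge_k] /=; last first.
  case: eqP => // n1; case: eqP => // n2.
  by have -> : k - N.*2 < n by lia.
have -> : (k == (N.*2 + n).+1) = false by lia.
have -> : (k == N.*2 + n) = false by lia.
rewrite /core_value /= /upd; have := odd_double_half k.
case: (odd k) => /= Ek.
  by rewrite if_same; case: eqP => // E; rewrite E in Ek.
case: (eqVneq k./2 1) => [E|ne]; first by rewrite -Ek E.
by case: eqP => // E; rewrite E in ne.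
Qed.

Lemma alive_stateS g :
  move (alive_state g) (table_step F (face_of (alive_state g))) =
  alive_state g.+1.
Proof.
rewrite /table_step; set b := face_bit _.
have Eb k : k <= (N.*2 + n).+1 -> b k = (0 < alive_value g k).
  exact: face_bit_state.
have Ecore : forall j, j < N.*2 -> b j = (0 < core_value (config_at g) j).
  move=> j lt_j; rewrite Eb; last by lia.
  rewrite /alive_value lt_j; have -> : (j == (N.*2 + n).+1) = false by lia.
  by have -> : (j == N.*2 + n) = false by lia.
have Eload j : N.*2 <= j -> j < N.*2 + n -> b j = (j - N.*2 < n - g).
  move=> ge_j lt_j; rewrite Eb; last by lia.
  rewrite /alive_value; have -> : (j == (N.*2 + n).+1) = false by lia.
  have -> : (j == N.*2 + n) = false by lia.
  by rewrite [j < N.*2]ltnNge ge_j /=; case: (j - _ < _).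
apply: move_state => [|k le_k]; first exact: step_trit_lt.
rewrite /alive_value /step_trit.
case: eqP => // n1; case: eqP => [//|n2]; first by rewrite addn2.
rewrite (Eload N.*2) // ?subnn; last by lia.
rewrite subn_gt0.
case: (ltnP k N.*2) => [lt_k|ge_k].
  case: (ltnP g n) => [lt_g|ge_g].
    rewrite /config_at (eqP (ltnW lt_g : g - n == 0)).
    rewrite (eqP (lt_g : g.+1 - n == 0)) /=.
    rewrite !(minn_idPl _) ?(ltnW lt_g) // /core_value /upd /=.
    have := odd_double_half k; case: (odd k) => /= Ek; last first.
      by rewrite ifF ?addn1 //; apply/eqP; lia.
    case: (eqVneq k./2 0) => [E|ne].
      have -> : (k == 1) by lia.
      by rewrite !E !upd_eq addn2.
    have -> : (k == 1) = false by lia.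
    by rewrite !upd_neq.
  have -> : config_at g.+1 = flow_step P (config_at g).
    by rewrite /config_at subSn // !(minn_idPr _) // ltnW.
  rewrite F_table // -(core_valueS N_gt1 P_bounded) ?config_at_bounded //.
  by congr addn; apply: core_trit_ext.
case: (ltnP g n) => [lt_g|ge_g]; last by lia.
rewrite Eload //; last by lia.
case: (eqVneq k.+1 (N.*2 + n)) => [Ek|nk] /=.
  by case: ifP; lia.
by rewrite Eload; try lia; case: ifP; lia.
Qed.

Lemma alive_state_halted g :
  face_bit (face_of (alive_state g)) 0 = ((config_at g).1 == 0).
Proof.
rewrite face_bit_state // /alive_value; have -> : (0 == N.*2 + n) = false by lia.
have -> : 0 < N.*2 by lia.
by rewrite /core_value /= [0 == _]eq_sym; case: (_ == 0).
Qed.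

End Dynamics.

(** * Killed walks are admissible *)

Section Admissible.
Local Open Scope ring_scope.
Variables (d : nat) (start : jump d.+1) (step : {set 'I_d.+1} -> jump d.+1).
Hypothesis start_pos : forall i, val (start i) != 0%N.
Hypothesis step_valid : forall (L : {set 'I_d.+1}) i, i \notin L ->
  val (step L i) != 0%N.
Hypothesis step_alive : forall L, step L ord0 = inord 1.

Local Notation p := (killed_walk start step).

Definition alive (L : {set 'I_d.+1}) : bool := (ord0 \in L) && ~~ face_bit L 0.

Lemma drainE (L : {set 'I_d.+1}) i :
  val (drain L i) = if i \in L then 0%N else 1%N.
Proof.
rewrite ffunE /drain_trit /face_bit leq_subr /= subKn; last by rewrite -ltnS.
by rewrite inord_val; case: (i \in L); rewrite inordK.
Qed.

Lemma move_drain (q : walk_state d.+1) i :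
  move q (drain (face_of q)) i = (q i).-1.
Proof.
rewrite ffunE /jump_coord.
have := drainE (face_of q) i; rewrite inE /= => ->.
by case: (q i) => [|m] //=; lia.
Qed.

Lemma killed_walk_sum L (f : jump d.+1 -> rat) :
  \sum_D p L D * f D =
  if L == finset.set0 then f start
  else if alive L then (f (step L) + f (drain L)) / 2
  else f (drain L).
Proof.
have pick (a : jump d.+1) : \sum_(D : jump d.+1) (D == a)%:R * f D = f a.
  rewrite (bigD1 a) //= eqxx mul1r big1 ?addr0 // => D /negbTE->.
  by rewrite mul0r.
rewrite /killed_walk /killed_weight -/(alive L); case: ifP => _;
  last case: ifP => _.
- rewrite -[RHS]pick; apply: eq_bigr => D _; rewrite natrM; congr (_ * _);
    by rewrite mulrC mulKf ?pnatr_eq0.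
- transitivity ((\sum_(D : jump d.+1) (D == step L)%:R * f D
      + \sum_(D : jump d.+1) (D == drain L)%:R * f D) / 2);
    last by rewrite !pick.
  rewrite -big_split mulr_suml; apply: eq_bigr => D _ /=.
  by rewrite natrD -mulrDl mulrAC.
- rewrite -[RHS]pick; apply: eq_bigr => D _; rewrite natrM; congr (_ * _);
    by rewrite mulrC mulKf ?pnatr_eq0.
Qed.

Lemma killed_walk_ge0 L D : 0 <= p L D.
Proof. by rewrite divr_ge0. Qed.

Lemma killed_walk_table : is_transition_table p.
Proof.
split=> [L D|L|L D i iL]; first exact: killed_walk_ge0.
  have := killed_walk_sum L (fun=> 1); rewrite (eq_bigr (p L)) => [->|D _].
    by do !case: ifP => _ //; lra.
  by rewrite mulr1.
move=> /eqP; rewrite /jump_coord -subr_eq0 opprK subrK => /eqP [Di].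
have neq (a : jump d.+1) : val (a i) != 0%N -> (D == a) = false.
  by apply: contra_neqF => /eqP <-.
rewrite /killed_walk /killed_weight (neq start) // (neq (step L)) ?step_valid //.
rewrite (neq (drain L)); last by rewrite drainE (negbTE iL).
by rewrite muln0 !if_same mul0r.
Qed.

Lemma trans_prob_iter_ge0 t q q' : 0 <= trans_prob_iter p t q q'.
Proof.
elim: t q => [|t IH] q /=; first by rewrite ler0n.
by apply: sumr_ge0 => D _; rewrite mulr_ge0 ?killed_walk_ge0.
Qed.

(** Draining has positive probability in every state other than the origin. *)
Lemma killed_walk_irreducible : irreducible_walk p.
Proof.
move=> q; have [m le_m] : exists m, forall i, (q i <= m)%N.
  by exists (\max_i q i)%N => i; apply: leq_bigmax.
elim: m q le_m => [|m IH] q le_m.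
  exists 0%N => /=; suff -> : q = origin _ by rewrite eqxx.
  by apply/ffunP => i; rewrite ffunE; apply/eqP; rewrite -leqn0.
have [E0|ne0] := eqVneq (face_of q) finset.set0.
  exists 0%N => /=; suff -> : q = origin _ by rewrite eqxx.
  apply/ffunP => i; rewrite ffunE; apply/eqP; rewrite -leqn0 leqNgt.
  by have /setP/(_ i) := E0; rewrite !inE => ->.
have [|t Ht] := IH (move q (drain (face_of q))).
  by move=> i; rewrite move_drain; have := le_m i; lia.
exists t.+1 => /=; rewrite killed_walk_sum (negbTE ne0).
case: ifP => // _.
by have := trans_prob_iter_ge0 t (move q (step (face_of q))) (origin _); lra.
Qed.

Definition alive_weight (i : 'I_d.+1) : rat := if i == ord0 then d.+1%:R else 1.

(** Draining alone decreases the weight by at least 1.  A step can only be taken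
    with the alive flag up, and then the drain taken with the same probability
    removes the weight [d.+1] of the flag against a gain of at most [d]. *)
Lemma killed_walk_lyapunov : linear_lyapunov p alive_weight.
Proof.
exists (1 / 2) => // L L0.
pose W (D : jump d.+1) : rat :=
  \sum_(i < d.+1) alive_weight i * (jump_coord (D i))%:~R.
rewrite (eq_bigr (fun D => p L D * W D)) => [|D _]; last by rewrite mulrC.
rewrite killed_walk_sum (negbTE L0).
have w_gt0 i : 1 <= alive_weight i.
  by rewrite /alive_weight; case: ifP => // _; rewrite ler1n.
have drain_le i : i \in L -> W (drain L) <= - alive_weight i.
  move=> iL; rewrite /W (bigD1 i) //= /jump_coord drainE iL mulrN1 gerDl.
  apply: sumr_le0 => j _; rewrite drainE; case: ifP => _; last by rewrite mulr0.
  by rewrite mulrN1 oppr_le0 (le_trans _ (w_gt0 j)).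
have [i iL] := set0Pn _ L0.
have drain_le1 : W (drain L) <= -1.
  by apply: le_trans (drain_le i iL) _; rewrite lerN2.
case: ifP => [/andP[aL _]|_]; last by lra.
have := drain_le _ aL; rewrite {1}/alive_weight eqxx => Hd.
suff : W (step L) <= d%:R by rewrite -natr1 in Hd; lra.
rewrite /W big_ord_recl step_alive /jump_coord inordK // subrr mulr0 add0r.
have -> : d%:R = \sum_(i < d) (1 : rat) by rewrite sumr_const card_ord.
apply: ler_sum => j _; rewrite /alive_weight /= mul1r.
by case: (step L _) => -[|[|[|]]].
Qed.

End Admissible.

(** * Sums of nonnegative families *)

Section Sums.
Local Open Scope ring_scope.
Local Open Scope classical_set_scope.
Variable R : realType.
Implicit Types T U : choiceType.

Lemma esum_exchange T U (f : T -> U -> \bar R) : (forall x y, 0 <= f x y)%E ->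
  (\esum_(x in [set: T]) \esum_(y in [set: U]) f x y =
   \esum_(y in [set: U]) \esum_(x in [set: T]) f x y)%E.
Proof.
move=> f0; rewrite !esum_esum //.
apply: (@reindex_esum R _ _ ([set: U] `*`` fun=> [set: T])
  ([set: T] `*`` fun=> [set: U]) (fun k => (k.2, k.1)) (fun k => f k.1 k.2)).
split=> [[x y] //|[x y] [x' y'] _ _ /= [-> ->] //|[y x] _].
by exists (x, y).
Qed.

Lemma esum_pick T (a : T) (f : T -> \bar R) : (0 <= f a)%E ->
  (\esum_(x in [set: T]) (if x == a then f x else 0) = f a)%E.
Proof.
move=> f0; rewrite -[RHS]esum_set1 // [RHS]esum_mkcond; apply: eq_esum => x _.
suff -> : (x \in [set a]) = (x == a) by [].
by apply/idP/eqP; rewrite inE.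
Qed.

Lemma esum_ge1 T (a : T) (f : T -> \bar R) : (forall x, 0 <= f x)%E ->
  (f a <= \esum_(x in [set: T]) f x)%E.
Proof.
move=> f0; rewrite -{1}(esum_pick (f0 a)); apply: le_esum => x _.
by case: eqP.
Qed.

Lemma esum_squeeze T (f g : T -> R) :
  (forall x, 0 <= f x <= g x) ->
  (\esum_(x in [set: T]) (f x)%:E = \esum_(x in [set: T]) (g x)%:E)%E ->
  (\esum_(x in [set: T]) (g x)%:E < +oo)%E -> f = g.
Proof.
move=> fg E fin; apply/funext => a; apply/eqP.
have f0 x : (0 <= (f x)%:E)%E by rewrite lee_fin; case/andP: (fg x).
have gf0 x : (0 <= (g x - f x)%:E)%E.
  by rewrite lee_fin subr_ge0; case/andP: (fg x).
have fin_f : (\esum_(x in [set: T]) (f x)%:E)%E \is a fin_num.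
  by rewrite ge0_fin_numE; [rewrite E | apply: esum_ge0 => x _].
have : (\esum_(x in [set: T]) (g x - f x)%:E = 0)%E.
  have : (\esum_(x in [set: T]) ((f x)%:E + (g x - f x)%:E) =
      \esum_(x in [set: T]) (f x)%:E)%E.
    by rewrite E; apply: eq_esum => x _; rewrite -EFinD addrC subrK.
  rewrite esumD // => /(congr1 (fun x => x - \esum_(x in [set: T]) (f x)%:E)%E).
  by rewrite addeAC subee // add0e.
have := esum_ge1 a gf0; move=> + E0; rewrite E0 lee_fin subr_le0 => le_gf.
by rewrite eq_le le_gf; case/andP: (fg a) => _ ->.
Qed.

End Sums.

(** * Uniqueness of the stationary distribution *)

Section Uniqueness.
Local Open Scope ring_scope.
Local Open Scope classical_set_scope.
Variables (R : realType) (d : nat) (p : transition_table d).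
Hypotheses (p_table : is_transition_table p) (p_irr : irreducible_walk p).
Local Notation state := (walk_state d).
Local Notation K q q' := (ratr (trans_prob p q q') : R).

Lemma trans_prob_ge0 q q' : 0 <= K q q'.
Proof.
by rewrite ler0q; apply: sumr_ge0 => D _; case: p_table.
Qed.

Lemma trans_prob_move q q' c : 0 <= c :> R ->
  (c * K q q')%:E = (\sum_(D : jump d)
    if q' == move q D then (c * ratr (p (face_of q) D))%:E else 0)%E.
Proof.
move=> c0; rewrite /trans_prob rmorph_sum big_mkcond mulr_sumr -sumEFin /=.
apply: eq_bigr => D _; rewrite eq_sym; case: eqP => // _.
by rewrite mulr0.
Qed.

Lemma esum_trans_prob (f : state -> R) : (forall q, 0 <= f q) ->
  (\esum_(q' in [set: state]) \esum_(q in [set: state]) (f q * K q q')%:E =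
   \esum_(q in [set: state]) (f q)%:E)%E.
Proof.
move=> f0; rewrite esum_exchange => [|q' q];
  last by rewrite lee_fin mulr_ge0 ?trans_prob_ge0.
apply: eq_esum => q _.
have p0 D : 0 <= f q * ratr (p (face_of q) D).
  by rewrite mulr_ge0 // ler0q; case: p_table.
rewrite (eq_esum (b := fun q' => (\sum_(D : jump d) if q' == move q D then
  (f q * ratr (p (face_of q) D))%:E else 0)%E)); last by move=> *;
    apply: trans_prob_move.
rewrite esum_sum; last by move=> q' D _ _; case: ifP => // _; rewrite lee_fin.
under eq_bigr => D _ do
  rewrite (esum_pick (f := fun=> (f q * ratr (p (face_of q) D))%:E)) ?lee_fin //.
rewrite sumEFin -mulr_sumr -rmorph_sum.
by have [_ -> _] := p_table; rewrite rmorph1 mulr1.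
Qed.

(** Stationarity carries the mass of any state along a path to the origin. *)
Lemma stationary0 (f : state -> R) : (forall q, 0 <= f q) ->
  (forall q, \esum_(q' in [set: state]) (f q' * K q' q)%:E = (f q)%:E)%E ->
  f (origin d) = 0 -> forall q, f q = 0.
Proof.
move=> f0 fP f00 q; have [t] := p_irr q.
elim: t q => [|t IH] q /=.
  by rewrite ltr0n lt0b => /eqP->.
move=> pos; have [D [pD pt]] : exists D, 0 < p (face_of q) D /\
    0 < trans_prob_iter p t (move q D) (origin d).
  apply/not_existsP => H; move: pos; apply/negP; rewrite -leNgt.
  apply: sumr_le0 => D _.
  have p0 : 0 <= p (face_of q) D by case: p_table.
  have [E|pD] := eqVneq (p (face_of q) D) 0; first by rewrite E mul0r.
  rewrite mulr_ge0_le0 // leNgt; apply/negP => pt; apply: (H D).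
  by rewrite lt_def pD.
have fD := IH _ pt.
have : ((f q * K q (move q D))%:E <= 0)%E.
  rewrite -(_ : (f (move q D))%:E = 0%E); last by rewrite fD.
  rewrite -fP; apply: (esum_ge1 q (f := fun q' => (f q' * K q' (move q D))%:E)).
  by move=> q'; rewrite lee_fin mulr_ge0 ?trans_prob_ge0.
rewrite lee_fin => le0; apply/eqP; rewrite eq_le f0 andbT.
have : 0 < K q (move q D).
  rewrite ltr0q; apply: lt_le_trans pD _.
  rewrite /trans_prob (bigD1 D) //= lerDl; apply: sumr_ge0 => *; by case: p_table.
by move=> K0; rewrite -(pmulr_lle0 _ K0).
Qed.

(** The minimum [m] of two stationary distributions can only lose mass at each
    point in one step, and it loses none in total, so it is stationary.  Then so
    is [pi1 - m], which vanishes at the origin if [pi1] is the smaller one there,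
    hence everywhere. *)
Lemma stationary_unique (pi1 pi2 : state -> R) :
  stationary_distribution p pi1 -> stationary_distribution p pi2 -> pi1 = pi2.
Proof.
wlog le12 : pi1 pi2 / pi1 (origin d) <= pi2 (origin d).
  move=> H S1 S2; have [le|le] := leP (pi1 (origin d)) (pi2 (origin d)).
    exact: H.
  by symmetry; apply: H => //; apply: ltW.
move=> [ge1 sum1 st1] [ge2 sum2 st2].
pose m q := Num.min (pi1 q) (pi2 q).
have m0 q : 0 <= m q by rewrite le_min ge1 ge2.
have le1 q : m q <= pi1 q by rewrite ge_min lexx.
have le2 q : m q <= pi2 q by rewrite ge_min lexx orbT.
have le_fin q : (\esum_(q' in [set: state]) (m q' * K q' q)%:E <= (m q)%:E)%E.
  rewrite EFin_min le_min -st1 -st2; apply/andP; split; apply: le_esum => q' _;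
  by rewrite lee_fin ler_wpM2r ?trans_prob_ge0.
pose mP q := fine (\esum_(q' in [set: state]) (m q' * K q' q)%:E).
have mPE q : ((mP q)%:E = \esum_(q' in [set: state]) (m q' * K q' q)%:E)%E.
  rewrite fineK // ge0_fin_numE; first by apply: le_lt_trans (le_fin q) _;
    rewrite ltry.
  by apply: esum_ge0 => q' _; rewrite lee_fin mulr_ge0 ?trans_prob_ge0.
have summ : (\esum_(q in [set: state]) (m q)%:E < +oo)%E.
  apply: (@le_lt_trans _ _ 1%E); last by rewrite ltry.
  by rewrite -sum1; apply: le_esum => q _; rewrite lee_fin.
have EmP : mP = m.
  apply: esum_squeeze => //.
    move=> q; rewrite -!lee_fin mPE le_fin andbT.
    by apply: esum_ge0 => q' _; rewrite lee_fin mulr_ge0 ?trans_prob_ge0.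
  by rewrite -[RHS]esum_trans_prob //; apply: eq_esum => q _; rewrite mPE.
have Epi1 q : pi1 q - m q = 0.
  apply: (stationary0 (f := fun q => pi1 q - m q)) => {q}.
  - by move=> q; rewrite subr_ge0.
  - move=> q; rewrite EFinB -st1 -{2}EmP mPE.
    have -> : (\esum_(q' in [set: state]) (pi1 q' * K q' q)%:E =
      \esum_(q' in [set: state]) ((pi1 q' - m q') * K q' q)%:E +
      \esum_(q' in [set: state]) (m q' * K q' q)%:E)%E.
      rewrite -esumD => [|q' _|q' _]; last 2 first.
      + by rewrite lee_fin mulr_ge0 ?trans_prob_ge0 ?subr_ge0.
      + by rewrite lee_fin mulr_ge0 ?trans_prob_ge0.
      by apply: eq_esum => q' _; rewrite -EFinD -mulrDl subrK.
    by rewrite -mPE addeK.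
  - by rewrite /m (min_idPl le12) subrr.
apply: esum_squeeze; last by rewrite sum2 ltry.
  by move=> q; rewrite ge1 -[pi1 q](subrK (m q)) Epi1 add0r le2.
by rewrite sum1 sum2.
Qed.

End Uniqueness.

(** * The lifetime of an excursion *)

Section NatSums.
Local Open Scope ring_scope.
Local Open Scope classical_set_scope.
Variable R : realType.

Lemma esum_cvg_series (u : nat -> R) (l : R) : (forall g, 0 <= u g) ->
  series u @ \oo --> l -> (\esum_(g in [set: nat]) (u g)%:E = l%:E)%E.
Proof.
move=> u0 ul; rewrite -nneseries_esumT => [|g]; last by rewrite lee_fin.
apply: cvg_lim => //.
rewrite (_ : (fun n => _) = EFin \o series u).
  by apply: cvg_EFin => //; apply: nearW.
by apply/funext => n; rewrite /= sumEFin.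
Qed.

Lemma esum_recl (f : nat -> \bar R) : (forall g, 0 <= f g)%E ->
  (\esum_(g in [set: nat]) f g = f 0%N + \esum_(g in [set: nat]) f g.+1)%E.
Proof.
move=> f0; rewrite -nneseries_esumT // -nneseries_esumT // nneseries_recl //.
by rewrite -(nneseries_addn 1%N) //; congr (_ + _)%E;
  apply: eq_eseriesr => g _; rewrite addn1.
Qed.

Lemma esum_natZl (f : nat -> \bar R) (c : R) : (forall g, 0 <= f g)%E -> 0 <= c ->
  (\esum_(g in [set: nat]) (c%:E * f g) = c%:E * \esum_(g in [set: nat]) f g)%E.
Proof.
move=> f0 c0; rewrite -!nneseries_esumT //; last by move=> g; rewrite mule_ge0.
by rewrite nneseriesZl.
Qed.

End NatSums.

Section Survival.
Local Open Scope ring_scope.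
Local Open Scope classical_set_scope.
Variables (R : realType) (halted : nat -> bool).

(** The probability that an excursion from the origin is alive at age [g], when
    the state of age [g'] is halted exactly for [halted g']. *)
Fixpoint survival (g : nat) : R :=
  if g is g'.+1 then if halted g' then 0 else survival g' / 2 else 1.

Lemma survival_ge0 g : 0 <= survival g.
Proof. by elim: g => //= g IH; case: ifP => // _; rewrite divr_ge0. Qed.

Lemma survivalS g : survival g.+1 <= survival g / 2.
Proof. by rewrite /=; case: ifP => // _; rewrite divr_ge0 ?survival_ge0. Qed.

Lemma survival_le g : survival g <= (1 / 2) ^+ g.
Proof.
elim: g => [|g IH] //; apply: le_trans (survivalS g) _.
by rewrite exprSr !div1r ler_wpM2r // ?invr_ge0 // -div1r.
Qed.

Definition death g := survival g - survival g.+1.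

Lemma death_ge0 g : 0 <= death g.
Proof. by rewrite /death; have := survivalS g; have := survival_ge0 g; lra. Qed.

Lemma survival_cvg0 : (fun g => survival g) @ \oo --> (0 : R).
Proof.
apply: (@squeeze_cvgr _ _ _ _ (fun=> 0) (fun g => (1 / 2) ^+ g)).
- by apply: nearW => g; rewrite survival_ge0 survival_le.
- exact: cvg_cst.
- by apply: cvg_expr; rewrite ger0_norm //; lra.
Qed.

Lemma natmul_le_expr g : g%:R <= 2 * (3 / 2) ^+ g :> R.
Proof.
elim: g => [|g IH]; first by rewrite expr0 mulr1.
have : 1 <= (3 / 2) ^+ g :> R by rewrite exprn_ege1 //; lra.
by rewrite exprS -(natr1 g); move: IH; move: ((3 / 2) ^+ g) => x; lra.
Qed.

Lemma natmul_survival_cvg0 : (fun g => g%:R * survival g) @ \oo --> (0 : R).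
Proof.
apply: (@squeeze_cvgr _ _ _ _ (fun=> 0) (fun g => 2 * (3 / 4) ^+ g)).
- apply: nearW => g; rewrite mulr_ge0 ?survival_ge0 //=.
  apply: (@le_trans _ _ (2 * (3 / 2) ^+ g * (1 / 2) ^+ g)).
    by rewrite ler_pM ?survival_ge0 ?natmul_le_expr ?survival_le.
  by rewrite -mulrA -exprMn; have -> : 3 / 2 * (1 / 2) = 3 / 4 :> R by lra.
- exact: cvg_cst.
- by rewrite -[X in _ --> X](mulr0 2); apply: cvgMr; apply: cvg_expr;
    rewrite ger0_norm //; lra.
Qed.

Definition lifetime : R := lim (series survival @ \oo).

(** Equality holds as long as no age below [n] is halted, and a halted age [h]
    costs [survival h] on the left once and for all: this is the gap between the
    two answers. *)
Lemma series_survival_le n : series survival n + 2 * survival n <= 2.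
Proof.
elim: n => [|n IH]; first by rewrite /series /= big_geq // add0r mulr1.
by rewrite seriesSr; have := survivalS n; lra.
Qed.

Lemma series_survival_cvg : series survival @ \oo --> lifetime.
Proof.
apply: nondecreasing_is_cvgn.
  by apply: nondecreasing_series => g _ _; apply: survival_ge0.
exists 2 => _ [n _ <-]; have := series_survival_le n; have := survival_ge0 n; lra.
Qed.

Lemma lifetime_le c n0 : (forall n, (n0 <= n)%N -> series survival n <= c) ->
  lifetime <= c.
Proof.
move=> le_c; apply: (limr_le (cvgP _ series_survival_cvg)).
by exists n0 => // n /= le_n; apply: le_c.
Qed.

Lemma lifetime_ge1 : 1 <= lifetime.
Proof.
have nd : nondecreasing_seq (series survival).
  by apply: nondecreasing_series => g _ _; apply: survival_ge0.
have := nondecreasing_cvgn_le nd (cvgP _ series_survival_cvg) 1%N.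
by rewrite /series /= big_nat1.
Qed.

Lemma lifetime_unhalted : (forall g, ~~ halted g) -> lifetime = 2.
Proof.
move=> nh; apply: cvg_lim => //.
rewrite (_ : series survival = fun n => 2 - 2 * survival n); last first.
  apply/funext; elim=> [|n IH]; first by rewrite /series /= big_geq // mulr1
    subrr.
  by rewrite seriesSr IH /= (negbTE (nh n)); lra.
rewrite -[X in _ --> X](subr0 2) -(mulr0 2).
by apply: cvgB; [exact: cvg_cst | apply: cvgMr; exact: survival_cvg0].
Qed.

Lemma lifetime_halted h : halted h -> lifetime < 2.
Proof.
move=> Hh; have [h0 Hh0 min_h0] := ex_minnP (ex_intro halted h Hh).
have pos g : (g <= h0)%N -> 0 < survival g.
  elim: g => [|g IH] lt_g //=; case: ifP => [/min_h0|_];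
    first by rewrite leqNgt lt_g.
  by rewrite divr_gt0 // IH // ltnW.
suff : lifetime <= 2 - survival h0 by have := pos _ (leqnn h0); lra.
apply: (@lifetime_le _ h0.+1) => n /subnKC <-.
move: (n - h0.+1)%N => {n} n.
suff : series survival (h0.+1 + n)%N + 2 * survival (h0.+1 + n)
    <= 2 - survival h0.
  by have := survival_ge0 (h0.+1 + n); lra.
elim: n => [|m IH].
  by rewrite addn0 seriesSr /= Hh0; have := series_survival_le h0; lra.
by rewrite addnS seriesSr; have := survivalS (h0.+1 + m); lra.
Qed.

Lemma series_death_cvg : series death @ \oo --> (1 : R).
Proof.
rewrite (_ : series death = fun n => 1 - survival n); last first.
  apply/funext; elim=> [|n IH]; first by rewrite /series /= big_geq // subrr.
  by rewrite seriesSr IH /death; lra.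
by rewrite -[X in _ --> X](subr0 1); apply: cvgB;
  [exact: cvg_cst | exact: survival_cvg0].
Qed.

(** Summation by parts.  A death at age [g] is followed by the [g.+1] steps that
    bring the clock from [g.+1] to 0; that is why the length of an excursion does
    not depend on what the program computes. *)
Lemma series_mass_cvg :
  series (fun g => survival g + g.+1%:R * death g) @ \oo --> 2 * lifetime.
Proof.
rewrite (_ : series _ = fun n => 2 * series survival n - n%:R * survival n);
  last first.
  apply/funext; elim=> [|n IH]; first by rewrite /series /= !big_geq // mulr0
    mul0r subrr.
  by rewrite !seriesSr IH /death -(natr1 n); ring.
rewrite -[X in _ --> X](subr0 _).
apply: cvgB; last exact: natmul_survival_cvg0.
by apply: cvgMr; exact: series_survival_cvg.
Qed.

End Survival.

(** * The stationary distribution of a killed walk *)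

Section Existence.
Local Open Scope ring_scope.
Local Open Scope classical_set_scope.
Variables (R : realType) (d : nat) (start : jump d.+1)
  (step : {set 'I_d.+1} -> jump d.+1) (ck : 'I_d.+1) (s : nat -> walk_state d.+1).
Hypothesis start_pos : forall i, val (start i) != 0%N.
Hypothesis step_valid : forall (L : {set 'I_d.+1}) i, i \notin L ->
  val (step L i) != 0%N.
Hypothesis step_alive : forall L, step L ord0 = inord 1.
Hypothesis s0 : s 0 = move (origin d.+1) start.
Hypothesis sS : forall g, s g.+1 = move (s g) (step (face_of (s g))).
Hypothesis s_alive : forall g, s g ord0 = 1%N.
Hypothesis s_clock : forall g, s g ck = g.+1.

Local Notation state := (walk_state d.+1).
Local Notation p := (killed_walk start step).
Local Notation K q q' := (ratr (trans_prob p q q') : R).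

Definition halted_at g := face_bit (face_of (s g)) 0.

Definition drained (j : nat) (q : state) : state := [ffun i => (q i - j)%N].

Lemma move_le (q : state) (D : jump d.+1) i : (move q D i <= (q i).+1)%N.
Proof. by rewrite ffunE /jump_coord; case: (D i) => -[|[|[|]]] //=; lia. Qed.

(** Every coordinate starts at most at 1 and gains at most 1 per step, as the
    clock does, so the clock is the last coordinate to be drained. *)
Lemma s_le g i : (s g i <= g.+1)%N.
Proof.
elim: g => [|g IH]; rewrite ?s0 ?sS; apply: leq_trans (move_le _ _ _) _ => //.
by rewrite ffunE.
Qed.

Lemma drained_all g : drained g.+1 (s g) = origin d.+1.
Proof. by apply/ffunP => i; rewrite !ffunE; apply/eqP; rewrite subn_eq0 s_le. Qed.

Lemma drained_neq0 g j : (j <= g)%N -> drained j (s g) != origin d.+1.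
Proof.
move=> le_j; apply/eqP => /ffunP/(_ ck); rewrite !ffunE s_clock.
by lia.
Qed.

Lemma face_neq0 (q : state) i : (0 < q i)%N -> (face_of q == finset.set0) = false.
Proof. by move=> q0; apply/eqP => /setP/(_ i); rewrite !inE q0. Qed.

Lemma move_drained j (q : state) :
  move (drained j q) (drain (face_of (drained j q))) = drained j.+1 q.
Proof. by apply/ffunP => i; rewrite move_drain !ffunE subnS. Qed.

Lemma trans_probE q q' : K q q' =
  if face_of q == finset.set0 then (move q start == q')%:R
  else if alive (face_of q) then
    ((move q (step (face_of q)) == q')%:R
     + (move q (drain (face_of q)) == q')%:R) / 2
  else (move q (drain (face_of q)) == q')%:R.
Proof.
have -> : trans_prob p q q' = \sum_D p (face_of q) D * (move q D == q')%:R.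
  rewrite /trans_prob big_mkcond; apply: eq_bigr => D _.
  by case: ifP; rewrite ?mulr1 ?mulr0.
rewrite killed_walk_sum; do 2?case: ifP => _; rewrite ?rmorph_nat //.
by rewrite fmorph_div rmorphD !rmorph_nat.
Qed.

Lemma alive_s g : alive (face_of (s g)) = ~~ halted_at g.
Proof. by rewrite /alive inE s_alive. Qed.

Local Notation a := (survival R halted_at).
Local Notation b := (death R halted_at).

Lemma trans_prob_alive g q :
  a g * K (s g) q = a g.+1 * (s g.+1 == q)%:R + b g * (drained 1 (s g) == q)%:R.
Proof.
have s_drain : move (s g) (drain (face_of (s g))) = drained 1 (s g).
  by apply/ffunP => i; rewrite move_drain ffunE subn1.
rewrite trans_probE (face_neq0 (i := ord0)) ?s_alive // alive_s s_drain -sS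
  /death /=.
by case: (halted_at g) => /=; field.
Qed.

Lemma trans_prob_drained g j q : (0 < j <= g)%N ->
  K (drained j (s g)) q = (drained j.+1 (s g) == q)%:R.
Proof.
move=> /andP[j0 le_j]; rewrite trans_probE move_drained (face_neq0 (i := ck)).
  by rewrite /alive inE ffunE s_alive; have -> : (1 - j = 0)%N by lia.
by rewrite ffunE s_clock; lia.
Qed.

Lemma trans_prob_origin q : K (origin d.+1) q = (s 0 == q)%:R.
Proof.
rewrite trans_probE -s0 ifT //; apply/eqP/setP => i.
by rewrite !inE ffunE.
Qed.

(** Mass that age [g] puts on [q] per visit to the origin: that of the alive state
    and, for the excursions that die at this age, that of the states draining from
    it, the last of which is the origin itself. *)
Definition excursion g (q : state) : R :=
  a g * (s g == q)%:R + b g * \sum_(1 <= j < g.+2) (drained j (s g) == q)%:R.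

Lemma excursion_ge0 g q : 0 <= excursion g q.
Proof.
apply: addr_ge0; rewrite mulr_ge0 ?survival_ge0 ?death_ge0 ?ler0n //.
by apply: sumr_ge0 => j _; rewrite ler0n.
Qed.

Lemma esum_excursion g (v : state -> R) : (forall q, 0 <= v q) ->
  (\esum_(q in [set: state]) (excursion g q * v q)%:E =
   (a g * v (s g) + b g * \sum_(1 <= j < g.+2) v (drained j (s g)))%:E)%E.
Proof.
move=> v0.
have pick (c : R) x : 0 <= c ->
    (\esum_(q in [set: state]) (c * (x == q)%:R * v q)%:E = (c * v x)%:E)%E.
  move=> c0; rewrite -[RHS](esum_pick (f :=
    fun q => (c * v q)%:E)) ?lee_fin ?mulr_ge0 //.
  apply: eq_esum => q _; rewrite eq_sym; case: eqP => _; first by rewrite mulr1.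
  by rewrite mulr0 mul0r.
have b0 := death_ge0 R halted_at g; have a0 := survival_ge0 R halted_at g.
have ge0 (c : R) x q : 0 <= c -> 0 <= c * (x == q)%:R * v q.
  by move=> c0; rewrite !mulr_ge0 ?ler0n.
rewrite (eq_esum (b := fun q => (a g * (s g == q)%:R * v q)%:E +
  \sum_(1 <= j < g.+2) (b g * (drained j (s g) == q)%:R * v q)%:E)%E); last first.
  move=> q _; rewrite sumEFin -EFinD; congr EFin.
  by rewrite /excursion mulrDl -mulrA; congr (_ + _);
    rewrite -mulr_suml -mulr_sumr.
rewrite esumD => [|q _|q _]; last 2 first.
- by rewrite lee_fin ge0.
- by apply: sume_ge0 => j _; rewrite lee_fin ge0.
rewrite pick // esum_sum => [|q j _ _]; last by rewrite lee_fin ge0.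
rewrite EFinD mulr_sumr -sumEFin; congr (_ + _)%E.
by apply: eq_bigr => j _; rewrite pick.
Qed.

(** The mass of age [g] moves to age [g.+1], to the states draining from age [g],
    and, from the origin, back to age 0. *)
Lemma excursion_step g q :
  a g * K (s g) q + b g * \sum_(1 <= j < g.+2) K (drained j (s g)) q =
  a g.+1 * (s g.+1 == q)%:R +
  (b g * (s 0 == q)%:R + b g * \sum_(1 <= j < g.+2) (drained j (s g) == q)%:R).
Proof.
rewrite trans_prob_alive big_nat_recr //= drained_all trans_prob_origin.
rewrite (eq_big_nat _ _ (F2 := fun j => (drained j.+1 (s g) == q)%:R));
  last first.
  by move=> j lt_j; apply: trans_prob_drained.
rewrite [in RHS]big_nat_recl // big_add1 /=; ring.
Qed.

Local Notation A := (lifetime R halted_at).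
Let c : R := (2 * A)^-1.

Lemma lifetime_gt0 : 0 < A.
Proof. exact: lt_le_trans ltr01 (lifetime_ge1 _ _). Qed.

Lemma c_ge0 : 0 <= c.
Proof. by rewrite invr_ge0 mulr_ge0 // ltW // lifetime_gt0. Qed.

(** Excursions last [2 * A] steps on average, the return to the origin included. *)
Definition occupation (q : state) : R :=
  c * fine (\esum_(g in [set: nat]) (excursion g q)%:E).

Lemma esum_mass :
  (\esum_(g in [set: nat]) \esum_(q in [set: state]) (excursion g q)%:E =
    (2 * A)%:E)%E.
Proof.
rewrite -(@esum_cvg_series R _ _ _ (@series_mass_cvg R halted_at)) => [|g];
  last first.
  by rewrite addr_ge0 ?mulr_ge0 ?survival_ge0 ?death_ge0.
apply: eq_esum => g _; have := esum_excursion g (v := fun=> 1) (fun=> ler01).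
under eq_esum => q _ do rewrite mulr1.
by move=> ->; rewrite mulr1 sumr_const_nat subSS subn0 mulrC.
Qed.

Lemma occupationE q :
  ((occupation q)%:E = c%:E * \esum_(g in [set: nat]) (excursion g q)%:E)%E.
Proof.
rewrite EFinM fineK // ge0_fin_numE; last by apply: esum_ge0 => g _;
  rewrite lee_fin excursion_ge0.
apply: (@le_lt_trans _ _ (2 * A)%:E); last by rewrite ltry.
rewrite -esum_mass; apply: le_esum => g _.
by apply: (esum_ge1 q (f := fun q => (excursion g q)%:E)) => q';
  rewrite lee_fin excursion_ge0.
Qed.

Lemma esum_death : (\esum_(g in [set: nat]) (b g)%:E = 1)%E.
Proof.
by apply: esum_cvg_series (@series_death_cvg R halted_at) => g; apply: death_ge0.
Qed.

Lemma occupation_origin : occupation (origin d.+1) = c.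
Proof.
apply: EFin_inj; rewrite occupationE (eq_esum (b := fun g => (b g)%:E)).
  by rewrite esum_death mule1.
move=> g _; congr EFin; rewrite /excursion big_nat_recr //= drained_all eqxx.
rewrite big_nat big1 ?add0r => [|j /andP[_ lt_j]]; last first.
  by rewrite (negbTE (drained_neq0 _)) // -ltnS.
have -> : (s g == origin d.+1) = false.
  by apply/negP => /eqP/ffunP/(_ ord0); rewrite ffunE s_alive.
by rewrite mulr0 mulr1 add0r.
Qed.

Lemma esum_occupation (v : state -> R) : (forall q, 0 <= v q) ->
  (\esum_(q in [set: state]) (occupation q * v q)%:E =
   c%:E * \esum_(g in [set: nat])
     (a g * v (s g) + b g * \sum_(1 <= j < g.+2) v (drained j (s g)))%:E)%E.
Proof.
move=> v0; have ge0 g q : (0 <= (excursion g q * v q)%:E)%E.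
  by rewrite lee_fin mulr_ge0 ?excursion_ge0.
have cv0 q : 0 <= c * v q by rewrite mulr_ge0 ?c_ge0.
transitivity (\esum_(q in [set: state]) \esum_(g in [set: nat])
    (excursion g q * (c * v q))%:E)%E.
  apply: eq_esum => q _; rewrite EFinM occupationE [(c%:E * _)%E]muleC -muleA
    -EFinM.
  rewrite muleC -esum_natZl // => [|g]; last by rewrite lee_fin excursion_ge0.
  by apply: eq_esum => g _; rewrite -EFinM mulrC.
rewrite esum_exchange => [|q g]; last by rewrite lee_fin mulr_ge0 ?excursion_ge0.
rewrite -esum_natZl ?c_ge0 // => [|g]; last first.
  by rewrite -(esum_excursion g (v := v)) // esum_ge0.
apply: eq_esum => g _; rewrite esum_excursion // -EFinM; congr EFin.
rewrite -mulr_sumr; ring.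
Qed.

Lemma occupation_stationary : stationary_distribution p occupation.
Proof.
split.
- move=> q; apply: mulr_ge0; first exact: c_ge0.
  by apply: fine_ge0; apply: esum_ge0 => g _; rewrite lee_fin excursion_ge0.
- under eq_esum => q _ do rewrite -[occupation q]mulr1.
  rewrite esum_occupation // -[X in (_ * X)%E](_ : ((2 * A)%:E = _)%E).
    by rewrite -EFinM mulVf // mulf_neq0 // gt_eqF // lifetime_gt0.
  rewrite -esum_mass; apply: eq_esum => g _.
  rewrite -(esum_excursion g (v := fun=> 1)) //.
  by apply: eq_esum => q _; rewrite mulr1.
- move=> q; rewrite esum_occupation => [|q'];
    last by rewrite ler0q sumr_ge0 // => D _; apply: killed_walk_ge0.
  rewrite occupationE; congr (_ * _)%E.
  have a0 := survival_ge0 R halted_at; have b0 := death_ge0 R halted_at.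
  have sum0 g : 0 <= b g * \sum_(1 <= j < g.+2) (drained j (s g) == q)%:R.
    by rewrite mulr_ge0 // sumr_ge0.
  rewrite (eq_esum (b := fun g => (a g.+1 * (s g.+1 == q)%:R)%:E +
    ((b g * (s 0 == q)%:R)%:E +
     (b g * \sum_(1 <= j < g.+2) (drained j (s g) == q)%:R)%:E))%E); last first.
    by move=> g _; rewrite excursion_step !EFinD.
  have S0 g : (0 <= (b g * \sum_(1 <= j < g.+2) (drained j (s g) == q)%:R)%:E)%E.
    by rewrite lee_fin sum0.
  have S1 g : (0 <= (a g * (s g == q)%:R)%:E)%E by rewrite lee_fin mulr_ge0.
  have S2 g : (0 <= (b g * (s 0 == q)%:R)%:E)%E by rewrite lee_fin mulr_ge0.
  rewrite !esumD //; try by move=> g _; rewrite adde_ge0.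
  rewrite addeA [X in (_ + X + _)%E](_ : _ = (a 0%N * (s 0 == q)%:R)%:E);
    last first.
    case: (s 0 == q); rewrite /= ?mulr1 ?mulr0.
      by rewrite -esum_death; apply: eq_esum => g _; rewrite mulr1.
    by apply: esum1 => g _; rewrite mulr0.
  rewrite [X in (X + _)%E]addeC -(esum_recl (f :=
    fun g => (a g * (s g == q)%:R)%:E)) // -esumD //.
Qed.

(** The origin has probability [(2 * A)^-1], and [A] is 2 without halting and
    smaller than 2 with it. *)
Lemma killed_walk_question :
  (exists pi : state -> R, unique (stationary_distribution p (R := R)) pi /\
     pi (origin d.+1) <= ratr (1 / 4)%R) <-> (forall g, ~~ halted_at g).
Proof.
have A0 := lifetime_gt0.
have r4 : ratr (1 / 4) = 1 / 4 :> R by rewrite fmorph_div rmorph1 rmorph_nat.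
have p_table := killed_walk_table start_pos step_valid.
have p_irr := killed_walk_irreducible start step.
split=> [[pi [[st _] le4]] g|nh].
  rewrite -(stationary_unique p_table p_irr occupation_stationary st) in le4.
  apply/negP => /(lifetime_halted R) lt2.
  move: le4; rewrite occupation_origin /c r4 div1r lef_pV2 ?posrE; lra.
exists occupation; split.
  split; first exact: occupation_stationary.
  move=> pi st; exact: stationary_unique occupation_stationary st.
by rewrite occupation_origin /c (lifetime_unhalted R nh) r4; lra.
Qed.

End Existence.

(** * Unbounded search *)

Lemma exists_bound P : exists N, 1 < N /\ all (instr_bounded N) P.
Proof.
elim: P => [|i P [N [N1 HN]]]; first by exists 2.
have mono N' : N <= N' -> all (instr_bounded N') P.
  move=> le_N; apply: sub_all HN => -[t|r t|r t t'] /=; lia.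
case: i => [t|r t|r t t'].
- by exists (N + t.+1); rewrite /= mono; lia.
- by exists (N + r.+1 + t.+1); rewrite /= mono; lia.
- by exists (N + r.+1 + t.+1 + t'.+1); rewrite /= mono; lia.
Qed.

Section Search.
Variable g : seq nat -> nat.
Hypotheses (Hg : computable g) (g01 : forall l, g l <= 1).

(** Register 2 is the flag of a loop whose round [t] lowers the flag and raises it
    again if [g] is 1 at [t]. *)
Lemma exists_search : exists P N, [/\ 1 < N, all (instr_bounded N) P
  & forall e, (exists T, (iter T (flow_step P) (start_config e)).1 = 0) <->
              (exists t, g [:: e; t] = 0)].
Proof.
(* Registers 0, 1 and 2 hold the input, the candidate and the flag. *)
have [c Hc] := Hg (vars := [:: 0; 1]) (m := 3) isT.
pose body := Seq c (Seq (Inc 1) (Loop 3 (Inc 2))).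
pose P := IJmp 0 :: IInc 2 2 :: flat (Loop 2 body) 2 0.
have [N [N1 HN]] := exists_bound P.
exists P, N; split=> // e.
have placed_body : placed P (flat body 3 2) 3 by [].
have round t s : s 0 = e -> s 1 = t -> s 2 = 1 -> exists T s',
    [/\ iter T.+1 (flow_step P) (2, s) = (2, s'), s' 0 = e, s' 1 = t.+1
      & s' 2 = g [:: e; t]].
  move=> s_e s_t s_f.
  have [s1 [A1 A2 A3]] := Hc (upd s 2 0).
  have [//|s2 [B1 B2 B3]] := @exec_move 3 2 (upd s1 1 (s1 1).+1).
  have E : exec body (upd s 2 0) s2.
    by apply: ExecSeq A1 _; apply: ExecSeq (ExecInc _ _) B1.
  have [T HT] := flow_run_exec E placed_body.
  exists T, s2; split.
  - by rewrite iterSr -HT /= s_f.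
  - by rewrite B3 // upd_neq // A3 // upd_neq.
  - by rewrite B3 // upd_eq A3 // upd_neq // s_t.
  - by rewrite B2 !upd_neq // A3 // upd_eq add0n A2 /= /upd /= s_e s_t.
have reach t : (forall u, u < t -> g [:: e; u] != 0) -> exists T s,
    [/\ t <= T, iter T (flow_step P) (start_config e) = (2, s)
      & [/\ s 0 = e, s 1 = t & s 2 = 1]].
  elim: t => [|t IH] Ht.
    by exists 1, (upd (upd (fun=> 0) 0 e) 2 1).
  have [|T [s [le_T ET [s_e s_t s_f]]]] := IH.
    by move=> u lt_u; apply: Ht; apply: ltnW.
  have [T' [s' [ET' s'_e s'_t s'_f]]] := round t s s_e s_t s_f.
  exists (T'.+1 + T), s'; split.
  - by rewrite addSn ltnS (leq_trans le_T) ?leq_addl.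
  - by rewrite iterD ET.
  - split=> //; rewrite s'_f; have := Ht t (leqnn _); have := g01 [:: e; t].
    by case: (g _) => [|[]].
split=> [[T HT]|[t0 Ht0]].
  apply: contrapT => H.
  have [|T' [s [le_T ET _]]] := reach T.
    by move=> u _; apply/eqP => Hu; apply: H; exists u.
  have stuck k s' : iter k (flow_step P) (0, s') = (0, s').
    by elim: k => //= k ->.
  move: HT ET; rewrite -(subnK le_T) iterD.
  by case: (iter T _ _) => pc s' /= ->; rewrite stuck.
have [t Ht min_t] := ex_minnP
  (ex_intro (fun t => g [:: e; t] == 0) t0 (introT eqP Ht0)).
have [|T [s [_ ET [s_e s_t s_f]]]] := reach t.
  by move=> u lt_u; apply/negP => /min_t; rewrite leqNgt lt_u.
have [T' [s' [ET' _ _ s'_f]]] := round t s s_e s_t s_f.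
exists (T'.+1 + T).+1; rewrite iterS iterD ET ET' /=.
by rewrite s'_f (eqP Ht).
Qed.

End Search.

(** * The table instance *)

Section TableInstance.
Variables (P : seq instr) (N F n : nat).
Hypotheses (N_gt1 : 1 < N) (P_bounded : all (instr_bounded N) P) (n_gt0 : 0 < n).
Hypothesis F_table : forall b k, k < N.*2 ->
  digit 3 F (core_index N.*2 b * N.*2 + k) = core_trit P N b k.

Lemma table_start_pos i : val (table_start N.*2 n i) != 0.
Proof.
by rewrite ffunE /= inordK ?start_trit_lt // /start_trit; case: ifP.
Qed.

Lemma mem_face_bit d (L : {set 'I_d.+1}) (i : 'I_d.+1) :
  face_bit L (d - i) = (i \in L).
Proof. by rewrite /face_bit leq_subr subKn ?inord_val // -ltnS. Qed.

Lemma table_step_valid (L : {set 'I_(N.*2 + n).+2}) i :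
  i \notin L -> val (table_step F L i) != 0.
Proof.
rewrite -mem_face_bit ffunE /= inordK ?step_trit_lt //; apply: contraNneq.
move: (_ - i) (face_bit L) => k b; rewrite /step_trit.
case: ifP => // _; case: ifP => // _; case: ifP => _.
  by case: ifP => _; [case: ifP | case: ifP => // /andP[]].
by case: ifP => // lt_k; rewrite F_table //; apply: core_trit0.
Qed.

Lemma table_step_alive (L : {set 'I_(N.*2 + n).+2}) :
  table_step F L ord0 = inord 1.
Proof. by rewrite ffunE subn0 /step_trit eqxx. Qed.

Lemma table_instance_admissible : walk_admissible (table_instance N.*2 F n).
Proof.
split=> //.
- split; first exact: killed_walk_table table_start_pos table_step_valid.
  exact: killed_walk_irreducible.
- by move=> i; rewrite /= /table_weight; case: ifP.
- exact: (killed_walk_lyapunov _ table_step_alive).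
Qed.

Lemma table_instance_question (R : realType) :
  walk_question R (table_instance N.*2 F n) <->
  ~ exists T, (iter T (flow_step P) (start_config n)).1 = 0.
Proof.
pose s := alive_state P N n.
have s_alive g : s g ord0 = 1 by rewrite ffunE subn0 /alive_value eqxx.
have s_clock g : s g (inord 1) = g.+1.
  rewrite ffunE inordK // subn1 /alive_value eqxx.
  by have -> : (N.*2 + n == (N.*2 + n).+1) = false by lia.
have s0 : s 0 = move (origin _) (table_start N.*2 n).
  by rewrite (alive_state0 N_gt1 P_bounded n_gt0).
have sS g : s g.+1 = move (s g) (table_step F (face_of (s g))).
  by rewrite (alive_stateS N_gt1 P_bounded n_gt0 F_table).
apply: (iff_trans (killed_walk_question R table_start_pos table_step_valid
  s0 sS s_alive s_clock)).
have halted g : halted_at s g = ((config_at P n g).1 == 0).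
  exact: alive_state_halted.
split=> [nh [T HT]|nh g].
  have := nh (T + n); rewrite halted /config_at addnK (minn_idPr _) ?leq_addl //.
  by rewrite HT.
rewrite halted; apply/negP => /eqP; rewrite /config_at.
case: (ltnP g n) => [lt_g|le_g]; first by rewrite (eqP (ltnW lt_g : g - n == 0)).
by move=> HT; apply: nh; exists (g - n).
Qed.

End TableInstance.

(** * Undecidability *)

Lemma tm_runD (A : finType) (M : turing_machine A) n m c b :
  tm_run n c = Some b -> tm_run (M := M) (n + m) c = Some b.
Proof. by elim: n c => //= n IH c; case: tm_step => // c' /IH. Qed.

Lemma tm_answers_inj (A : finType) (M : turing_machine A) u b b' :
  tm_answers M u b -> tm_answers M u b' -> b = b'.
Proof.
move=> [n Hn] [m Hm]; have := tm_runD m Hn; have := tm_runD n Hm.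
by rewrite addnC => -> [].
Qed.

Theorem theorem2 (R : realType) :
  ~ exists M : turing_machine letter,
      tm_decides M encode_walk_instance walk_admissible (walk_question R).
Proof.
move=> [M M_decides].
(* A table [F] for a core of size [d0] is described by [e := pairn d0 F]; the
   instance with description [e] has [e] loader coordinates. *)
pose code e := instance_code M (fstn e) (sndn e) e.
pose g (l : seq nat) : nat := fstn (iter (nth 0 l 1) (@step_code _ M)
  (pairn (state_code (tm_start M)) (pairn 0 (code (nth 0 l 0))))) != 1.
have Hg : computable g.
  apply: computable_negb; apply: computable_run; last exact: computable_nth.
  by apply: computable_instance_code; computability.
have [//|P [N [N1 P_bounded searchP]]] := exists_search Hg.
  by move=> l; apply: leq_b1.
have [F F_table] := exists_core_table N1 P_bounded.
pose e := pairn N.*2 F.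
have e_gt0 : 0 < e by rewrite /e /pairn; nia.
pose I := table_instance N.*2 F e.
have gE t : (g [:: e; t] == 0) =
    (tm_run t (tm_init M (encode_walk_instance I)) == Some true).
  rewrite -run_code /config_code /= instance_codeE /g /code /= /e pairnK1 pairnK2.
  by case: (_ == 1).
have haltP : (exists T, (iter T (flow_step P) (start_config e)).1 = 0) <->
    tm_answers M (encode_walk_instance I) true.
  apply: (iff_trans (searchP e)); split=> [[t /eqP]|[t Ht]].
    by rewrite gE => /eqP Ht; exists t.
  by exists t; apply/eqP; rewrite gE Ht.
have questionP := table_instance_question N1 P_bounded e_gt0 F_table R.
have [|b [Mb bP]] := M_decides I.
  exact: table_instance_admissible N1 P_bounded F_table.
case: b Mb bP => Mb bP.
  by apply: (iffLR questionP (iffLR bP erefl)); apply/haltP.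
have : walk_question R I.
  by apply/questionP => /haltP Mtrue; have := tm_answers_inj Mb Mtrue.
by move/bP.
Qed.
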